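(* Assume the setting below and let $\alpha=\mathrm{Trd}(k_1k_2)$. Then, as integral ideals of $\mathcal{O}_L$, $$\mathfrak{d}^+\ \big|\ \left(4\,\mathrm{Nrd}(k_1)\mathrm{Nrd}(k_2)-\alpha^2\right).$$ Furthermore, $$\mathrm{N}_{L/\mathbb{Q}}(\mathfrak{d}^+)\le 4^g\,\frac{\mathrm{disc}(\mathcal{O}_1)\cdot\mathrm{disc}(\mathcal{O}_2)}{\mathrm{disc}(\mathcal{O}_L)^4}.$$
   Context: Setting: $L$ totally real of degree $g$ with strict class number one; $K_1,K_2$ CM fields with $K_i^+=L$. Write $\mathcal{O}_{K_i}=\mathcal{O}_L[\kappa_i]$ with $\kappa_i^2+B_i\kappa_i+C_i=0$, $B_i,C_i\in\mathcal{O}_L$, and $-m_i=B_i^2-4C_i$ (totally negative). $\mathcal{O}_i\subseteq K_i$ is an order containing $\mathcal{O}_L$ with conductor generated by $c_i\in\mathcal{O}_L$, so $\mathcal{O}_i=\mathcal{O}_L[c_i\kappa_i]$. $B$ is a totally definite quaternion algebra over $L$ (i.e. $B\otimes_{L,\sigma}\mathbb{R}$ is a division algebra for every real embedding $\sigma$), with reduced trace $\mathrm{Trd}$ and reduced norm $\mathrm{Nrd}$; $\varphi_i:K_i\to B$ are embeddings restricting to the identity on $L$ with $\varphi_1(K_1)\ne\varphi_2(K_2)$; $k_i=\varphi_i(c_i\sqrt{-m_i})$; $\mathcal{O}$ is an order of $B$ containing $\varphi_1(\mathcal{O}_1),\varphi_2(\mathcal{O}_2)$, and $\mathfrak{d}^+$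 is its (reduced) discriminant, an integral ideal of $\mathcal{O}_L$. $\mathrm{disc}$ denotes absolute discriminant (relative to $\mathbb{Z}$), a positive integer here. *)

(* Defs.v *)
From mathcomp Require Import all_boot all_order all_algebra all_field.
From mathcomp Require Import complex.
From mathcomp Require Import boolp classical_sets reals.
Set Implicit Arguments.
Unset Strict Implicit.
Unset Printing Implicit Defensive.
Import Order.TTheory GRing.Theory Num.Theory.
Local Open Scope classical_set_scope.
Local Open Scope ring_scope.

(* A number field is a [fieldExtType rat]; a field K containing it is a
   [fieldExtType L], and [baseFieldType K] is K viewed as an extension of rat.
   The elements of L sit in an L-algebra A as [a%:A]. *)

Definition ring_of_integers (F : fieldType) : set F :=
  [set x | integralOver (intr : int -> F) x].
Arguments ring_of_integers F : clear implicits.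

Definition totally_real (R : realType) (L : fieldExtType rat) : Prop :=
  forall (f : {rmorphism L -> R[i]}) (x : L), f x \is Num.real.

Definition totally_imaginary (R : realType) (F : fieldType) : Prop :=
  forall f : {rmorphism F -> R[i]}, exists x : F, f x \isn't Num.real.

(* Used with L totally real, which is then the maximal totally real subfield
   of K. *)
Definition CM_over (R : realType) (L : fieldExtType rat) (K : fieldExtType L)
    : Prop :=
  \dim {:K} = 2%N /\ totally_imaginary R K.

Definition totally_positive (R : realType) (L : fieldExtType rat) (a : L)
    : Prop :=
  forall f : {rmorphism L -> R}, 0 < f a.

Section Ideals.
Variable L : fieldExtType rat.
Local Notation OL := (ring_of_integers L).

Definition OL_submodule (I : set L) : Prop :=
  [/\ I 0, (forall x y, I x -> I y -> I (x + y))
    & (forall a x, OL a -> I x -> I (a * x))].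

Definition integral_ideal (I : set L) : Prop := OL_submodule I /\ I `<=` OL.

Definition fractional_ideal (I : set L) : Prop :=
  [/\ OL_submodule I, I <> [set 0]
    & exists2 d : L, OL d /\ d != 0 & forall x, I x -> OL (d * x)].

Definition principal (a : L) : set L := [set a * x | x in OL].

(* Triviality of the narrow class group, i.e. of the group of all fractional
   ideals modulo the principal ones with a totally positive generator. *)
Definition strict_class_number_one (R : realType) : Prop :=
  forall I : set L, fractional_ideal I ->
    exists2 a : L, totally_positive R a & I = principal a.

Definition ideal_mul (I J : set L) : set L :=
  [set x | exists n (u v : 'I_n -> L),
    [/\ (forall k, I (u k)), (forall k, J (v k)) & x = \sum_k u k * v k]].

Definition ideal_gen (X : set L) : set L := ideal_mul OL X.

Definition ideal_dvd (I J : set L) : Prop :=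
  exists2 E : set L, integral_ideal E & ideal_mul I E = J.

(* N = [O_L : I]: the r k form a system of representatives of O_L modulo I. *)
Definition is_ideal_norm (I : set L) (N : nat) : Prop :=
  exists2 r : 'I_N -> L, forall k, OL (r k) &
    forall x, OL x -> exists! k : 'I_N, I (x - r k).

End Ideals.

Section Orders.
Variables (L : fieldExtType rat) (A : falgType L).
Local Notation OL := (ring_of_integers L).

(* A subring of A which is a finitely generated O_L-module spanning A over L.
   These are exactly the orders of A that contain O_L. *)
Definition is_order (S : set A) : Prop :=
  [/\ S 1, (forall x y, S x -> S y -> S (x * y))
    & exists n (e : n.-tuple A), <<e>>%VS = {:A}%VS /\
        S = [set \sum_(k < n) a k *: e`_k
            | a in [set a : 'I_n -> L | forall k, OL (a k)]]].

End Orders.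

(* The subring O_L[z] of K. *)
Definition OL_adjoin (L : fieldExtType rat) (K : fieldExtType L) (z : K)
    : set K :=
  [set (map_poly (in_alg K) p).[z]
  | p in [set p : {poly L} | forall n, ring_of_integers L p`_n]].

Definition conductor (F : fieldType) (S : set F) : set F :=
  [set x | forall y, ring_of_integers F y -> S (x * y)].

Definition has_conductor (L : fieldExtType rat) (K : fieldExtType L)
    (S : set K) (c : L) : Prop :=
  conductor S = [set c%:A * x | x in ring_of_integers K].

Definition alg_trace (F : fieldType) (A : falgType F) (x : A) : F :=
  \sum_(k < \dim {:A}) coord (vbasis {:A}) k (x * (vbasis {:A})`_k).

(* d is the absolute value of det (Tr_(F/Q) (e_i e_j)), for a Z-basis e of S
   which is also a Q-basis of F. *)
Definition is_abs_disc (F : fieldExtType rat) (S : set F) (d : rat) : Prop :=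
  exists e : (\dim {:F}).-tuple F,
    [/\ basis_of {:F} e,
        S = range (fun z : 'I_(\dim {:F}) -> int => \sum_(k < \dim {:F}) e`_k *~ z k)
      & d = `| \det (\matrix_(k, l < \dim {:F}) alg_trace (e`_k * e`_l)) |].

(* Extension of scalars along f : F -> E of an F-algebra A with basis e: the
   vectors e_k (x) 1 form an E-basis, in which the elements of the extension
   are written as row vectors; the structure constants are those of A in e. *)
Section ScalarExtension.
Variables (F E : fieldType) (A : falgType F) (n : nat) (e : n.-tuple A).
Variable f : {rmorphism F -> E}.

Definition ext_one : 'rV[E]_n := \row_k f (coord e k 1).

Definition ext_mul (u v : 'rV[E]_n) : 'rV[E]_n :=
  \row_k \sum_i \sum_j u 0 i * v 0 j * f (coord e k (e`_i * e`_j)).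

Definition ext_division : Prop :=
  ext_one != 0 /\
  forall u, u != 0 -> exists v, ext_mul u v = ext_one /\ ext_mul v u = ext_one.

End ScalarExtension.

Section Quaternion.
Variables (L : fieldExtType rat) (B : falgType L) (i j : B).

Definition qbasis : 4.-tuple B := [tuple 1; i; j; i * j].

(* B is the quaternion algebra (a, b / L), with standard generators i and j. *)
Definition is_quaternion (a b : L) : Prop :=
  [/\ a != 0, b != 0 & basis_of {:B} qbasis]
  /\ [/\ i * i = a%:A, j * j = b%:A & j * i = - (i * j)].

Definition qconj (x : B) : B :=
  let q := coord qbasis in
  q 0 x *: 1 - q 1 x *: i - q 2%:R x *: j - q 3%:R x *: (i * j).

(* For a quaternion algebra x + qconj x and x * qconj x are scalars, so their
   coordinates on 1 are the reduced trace and norm. *)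
Definition Trd (x : B) : L := coord qbasis 0 (x + qconj x).
Definition Nrd (x : B) : L := coord qbasis 0 (x * qconj x).

Definition totally_definite (R : realType) : Prop :=
  forall f : {rmorphism L -> R}, ext_division qbasis f.

Definition disc_ideal (O : set B) : set L :=
  ideal_gen [set \det (\matrix_(k < 4, l < 4) Trd (x k * x l))
            | x in [set x : 'I_4 -> B | forall k, O (x k)]].

(* The reduced discriminant is the integral ideal whose square is the
   discriminant ideal. *)
Definition is_reduced_disc (O : set B) (d : set L) : Prop :=
  integral_ideal d /\ ideal_mul d d = disc_ideal O.

End Quaternion.

(* Main.v *)
(* Let D = 4 Nrd(k1) Nrd(k2) - alpha^2.  The trace form of (1, k1 k2, k1, k2)
   has determinant - D^2, so D^2 lies in the discriminant ideal d * d.  Since d is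
   principal and O_L is integrally closed, D lies in d, and N(d) <= |N(D)|.
   At each real embedding f, definiteness and the Cauchy-Schwarz inequality for
   the norm form give 0 <= f(D) <= 4 f(Nrd k1) f(Nrd k2), where
   Nrd(k_i) = c_i^2 m_i, and D <> 0 as otherwise k1 and k2 would be parallel and
   generate the same subfield.  Hence |N(D)| <= 4^g |N(c1^2 m1)| |N(c2^2 m2)|,
   while computing the trace form of O_i inside the lattice
   O_L + c_i kappa_i O_L shows disc(O_L)^2 |N(c_i^2 m_i)| <= disc(O_i). *)
Require Import Defs.
From HB Require Import structures.
From mathcomp Require Import all_boot all_order all_algebra all_field.
From mathcomp Require Import complex.
From mathcomp Require Import boolp classical_sets reals.
From mathcomp Require Import ring lra.
Set Implicit Arguments.
Unset Strict Implicit.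
Unset Printing Implicit Defensive.
Import Order.TTheory GRing.Theory Num.Theory.
Local Open Scope classical_set_scope.
Local Open Scope ring_scope.

(** * Coordinates, traces and norms *)

(** The two sides meet because [k_i ^ 2 = c_i ^ 2 (B_i ^ 2 - 4 C_i)] is also the relative
    discriminant of [(1, c_i kappa_i)]: the tower formula turns [|N(Nrd k_i)|] into a lattice
    discriminant divided by [disc(O_L) ^ 2], once per field, hence the fourth power. The factor
    [4 ^ g] is the norm of the scalar 4. Lattices are compared by inequalities: an integral change
    of basis multiplies a discriminant by a nonzero square, and [D O_L] inside [d] bounds the index
    of [d]. That [D] is nonzero also makes [d] nonzero, hence a fractional ideal with a generator,
    and makes [O_L / D O_L] finite. Norms are determinants of multiplication matrices; estimating
    them place by place requires writing such a determinant as a product over real embeddings, which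
    are built from the conjugates of a primitive element. *)

Lemma number_field_natr_neq0 (L : fieldExtType rat) n : (n.+1%:R : L) != 0.
Proof.
by rewrite -(rmorph_nat (in_alg L)) fmorph_eq0 pnatr_eq0.
Qed.

Section Coordinates.
Variables (F : fieldType) (A : falgType F).

Definition coord_mx n m (e : n.-tuple A) (e' : m.-tuple A) : 'M[F]_(n, m) :=
  \matrix_(k, l) coord e' l e`_k.

(** Coordinates are rows: row [k] is the image of the [k]-th basis vector, so products get reversed
    ([mul_mxM]). *)
Definition mul_mx n (e : n.-tuple A) (x : A) : 'M[F]_n :=
  \matrix_(k, l) coord e l (x * e`_k).

Definition trace_form n (e : n.-tuple A) : 'M[F]_n :=
  \matrix_(k, l) alg_trace (e`_k * e`_l).

Lemma coord_mx1 n (e : n.-tuple A) : free e -> coord_mx e e = 1%:M.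
Proof.
by move=> fe; apply/matrixP=> k l; rewrite !mxE coord_free // eq_sym.
Qed.

Lemma coord_mxM n m p (e : n.-tuple A) (e' : m.-tuple A) (e'' : p.-tuple A) :
  basis_of {:A} e' -> coord_mx e e' *m coord_mx e' e'' = coord_mx e e''.
Proof.
move=> be; apply/matrixP=> k l; rewrite !mxE.
rewrite [in RHS](coord_basis be (memvf e`_k)) linear_sum /=.
by apply: eq_bigr => j _; rewrite !mxE linearZ.
Qed.

Lemma mul_mxE n (e : n.-tuple A) x (k : 'I_n) :
  basis_of {:A} e -> x * e`_k = \sum_l mul_mx e x k l *: e`_l.
Proof.
move=> be; rewrite {1}(coord_basis be (memvf (x * e`_k))).
by apply: eq_bigr => j _; rewrite mxE.
Qed.

Lemma mul_mx_unique n (e : n.-tuple A) x (M : 'M[F]_n) :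
  free e -> (forall k : 'I_n, x * e`_k = \sum_l M k l *: e`_l) -> mul_mx e x = M.
Proof.
by move=> fe eM; apply/matrixP=> k l; rewrite mxE eM coord_sum_free.
Qed.

(** Both sides list the [e']-coordinates of [x * e_k]. An intertwining relation avoids inverses and
    allows two different index types. *)
Lemma mul_mx_coord n m (e : n.-tuple A) (e' : m.-tuple A) x :
  basis_of {:A} e -> basis_of {:A} e' ->
  mul_mx e x *m coord_mx e e' = coord_mx e e' *m mul_mx e' x.
Proof.
move=> be be'; apply/matrixP=> k l; rewrite !mxE.
transitivity (coord e' l (x * e`_k)).
  rewrite (mul_mxE _ _ be) linear_sum; apply: eq_bigr => j _.
  by rewrite linearZ /= [coord_mx _ _ _ _]mxE.
rewrite {1}(coord_basis be' (memvf e`_k)) mulr_sumr linear_sum.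
by apply: eq_bigr => j _; rewrite !mxE -scalerAr linearZ.
Qed.

Lemma alg_traceE n (e : n.-tuple A) x :
  basis_of {:A} e -> alg_trace x = \tr (mul_mx e x).
Proof.
move=> be; have bv := vbasisP {:A}.
have -> : alg_trace x = \tr (mul_mx (vbasis {:A}) x).
  by apply: eq_bigr => k _; rewrite mxE.
rewrite -[mul_mx e x]mulmx1 -(coord_mx1 (basis_free be)) -(coord_mxM _ _ bv).
rewrite mulmxA (mul_mx_coord _ be bv) -mulmxA mxtrace_mulC -mulmxA.
by rewrite (coord_mxM _ _ be) (coord_mx1 (basis_free bv)) mulmx1.
Qed.

Lemma det_mul_mx_basis n (e e' : n.-tuple A) x :
  basis_of {:A} e -> basis_of {:A} e' ->
  \det (mul_mx e x) = \det (mul_mx e' x).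
Proof.
move=> be be'; have U : \det (coord_mx e e') * \det (coord_mx e' e) = 1.
  by rewrite -det_mulmx coord_mxM // coord_mx1 ?det1 // (basis_free be).
have := congr1 (@determinant _ _) (mul_mx_coord x be be').
rewrite !det_mulmx => /(congr1 (fun y => y * \det (coord_mx e' e))).
by rewrite -mulrA U mulr1 mulrAC U mul1r.
Qed.

Lemma alg_traceD : {morph @alg_trace F A : x y / x + y}.
Proof.
move=> x y; rewrite /alg_trace -big_split; apply: eq_bigr => k _ /=.
by rewrite mulrDl linearD.
Qed.

Lemma alg_traceZ a : {morph @alg_trace F A : x / a *: x >-> a * x}.
Proof.
move=> x; rewrite /alg_trace mulr_sumr; apply: eq_bigr => k _ /=.
by rewrite -scalerAl linearZ.
Qed.

Lemma alg_trace_sum (I : Type) r (P : pred I) (G : I -> A) :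
  alg_trace (\sum_(k <- r | P k) G k) = \sum_(k <- r | P k) alg_trace (G k).
Proof.
apply: (big_morph _ alg_traceD); rewrite -[0 in LHS](scale0r 0) alg_traceZ.
by rewrite mul0r.
Qed.

Lemma alg_trace1 : alg_trace (1 : A) = (\dim {:A})%:R.
Proof.
rewrite (alg_traceE _ (vbasisP {:A})).
rewrite (mul_mx_unique (M := 1%:M)) ?mxtrace1 ?(basis_free (vbasisP _)) //.
move=> k; rewrite mul1r (bigD1 k) //= mxE eqxx scale1r big1 ?addr0 //.
by move=> l /negPf kl; rewrite mxE eq_sym kl scale0r.
Qed.

(** [P] is rectangular because one tuple may be indexed by [\dim] and the other by a sum, sizes that
    are equal only propositionally. *)
Lemma trace_form_congr n m (e : n.-tuple A) (w : m.-tuple A) (P : 'M_(n, m)) :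
  (forall k : 'I_n, e`_k = \sum_l P k l *: w`_l) ->
  trace_form e = P *m trace_form w *m P^T.
Proof.
move=> eP; apply/matrixP=> k l; rewrite [LHS]mxE !eP mulr_sumr alg_trace_sum.
rewrite [RHS]mxE; apply: eq_bigr => j _; rewrite [P^T _ _]mxE.
rewrite [(P *m _) _ _]mxE -scalerAr alg_traceZ mulrC; congr (_ * _).
rewrite mulr_suml alg_trace_sum; apply: eq_bigr => i _.
by rewrite [trace_form _ _ _]mxE -scalerAl alg_traceZ.
Qed.

End Coordinates.

Section TraceForm.
Variable F : fieldExtType rat.

(* The trace pairing is nondegenerate because Tr (x * x^-1) = Tr 1 <> 0. *)
Lemma det_trace_form_neq0 n (e : n.-tuple F) :
  basis_of {:F} e -> \det (trace_form e) != 0.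
Proof.
move=> be; apply/negP=> /det0P[v v0 vT].
pose x := \sum_k v 0 k *: e`_k.
have tr0 y : alg_trace (x * y) = 0.
  rewrite (coord_basis be (memvf y)) mulr_sumr alg_trace_sum big1 // => l _.
  rewrite -scalerAr alg_traceZ /x mulr_suml alg_trace_sum.
  have /matrixP/(_ 0 l) := vT; rewrite !mxE => eq0.
  rewrite [X in _ * X](_ : _ = 0) ?mulr0 // -[RHS]eq0.
  by apply: eq_bigr => k _; rewrite mxE -scalerAl alg_traceZ.
have x0 : x != 0.
  apply: contraNneq v0 => x0; apply/eqP/rowP=> k; rewrite mxE.
  by have /freeP := basis_free be; apply; exact: x0.
have := tr0 x^-1; rewrite mulfV // alg_trace1 => /eqP.
by apply/negP; rewrite pnatr_eq0 -lt0n adim_gt0.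
Qed.

Lemma trace_form_scaled n (e : n.-tuple F) x :
  basis_of {:F} e ->
  \matrix_(k, l) alg_trace (x * (e`_k * e`_l)) = mul_mx e x *m trace_form e.
Proof.
move=> be; apply/matrixP=> k l; rewrite [LHS]mxE mulrA (mul_mxE x k be).
rewrite mulr_suml alg_trace_sum mxE; apply: eq_bigr => j _.
by rewrite -scalerAl alg_traceZ [trace_form _ _ _]mxE.
Qed.

End TraceForm.

(** * Algebraic integers and orders *)

(** The predicate form lets the closure properties be registered once and gives access to
    [polyOver]. *)
Definition integers (F : fieldType) : {pred F} :=
  fun x => `[< ring_of_integers F x >].
Arguments integers F : clear implicits.

Lemma integersP (F : fieldType) x :
  reflect (ring_of_integers F x) (x \in integers F).
Proof. exact: asboolP. Qed.

Lemma integers_subring (F : fieldType) : subring_closed (integers F).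
Proof.
split=> [|x y /integersP Ix /integersP Iy|x y /integersP Ix /integersP Iy].
- by apply/integersP; apply: integral1.
- by apply/integersP; apply: integral_sub.
- by apply/integersP; apply: integral_mul.
Qed.

HB.instance Definition _ (F : fieldType) :=
  GRing.isSubringClosed.Build F (integers F) (@integers_subring F).

(** Transitivity of integrality, that is, integral closedness of the ring of integers. *)
Lemma integers_root (F : fieldType) (p : {poly F}) x :
  p \is monic -> p \is a polyOver (integers F) -> root p x -> x \in integers F.
Proof.
move=> mp /polyOverP pS px; apply/integersP; apply: integral_root_monic mp px _.
by apply/integral_poly=> k; apply/integersP.
Qed.

Lemma char_poly_over (R : comNzRingType) (S : subringClosed R) n (M : 'M[R]_n) :
  (forall k l, M k l \in S) -> char_poly M \is a polyOver S.
Proof.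
move=> MS; apply: rpred_sum => s _; rewrite rpredMsign; apply: rpred_prod => k _.
by rewrite !mxE rpredB ?polyOverC // rpredMn ?polyOverX.
Qed.

Lemma integers_sqr (F : fieldType) (x : F) :
  x ^+ 2 \in integers F -> x \in integers F.
Proof.
move=> x2; apply: (@integers_root _ ('X^2 - (x ^+ 2)%:P)).
- by rewrite monicXnsubC.
- by rewrite rpredB ?rpredX ?polyOverX // polyOverC.
- by rewrite rootE !hornerE subrr.
Qed.

Lemma integers_in_alg (F : fieldExtType rat) (K : fieldExtType F) (a : F) :
  (a%:A \in integers K) = (a \in integers F).
Proof.
apply/integersP/integersP=> [[p mp /rootP pa]|[p mp /rootP pa]]; exists p => //.
  apply/rootP/(fmorph_inj (in_alg K)).
  rewrite rmorph0 -horner_map -map_poly_comp /= -[RHS]pa; congr horner.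
  by apply: eq_map_poly => z; rewrite /= scaler_int.
apply/rootP; rewrite -[RHS](rmorph0 (in_alg K)) -[in RHS]pa -horner_map.
rewrite -map_poly_comp; congr horner.
by apply: eq_map_poly => z; rewrite /= scaler_int.
Qed.

Section Orders.
Variables (L : fieldExtType rat) (A : falgType L) (S : set A).
Hypothesis S_order : is_order S.

Lemma order_add x y : S x -> S y -> S (x + y).
Proof.
have [_ _ [n [e [_ ->]]]] := S_order.
move=> [u Iu <-] [v Iv <-]; exists (fun k => u k + v k).
  by move=> k; apply: integral_add; [apply: Iu | apply: Iv].
by rewrite -big_split; apply: eq_bigr => k _; rewrite /= scalerDl.
Qed.

Lemma order_scale a x : ring_of_integers L a -> S x -> S (a *: x).
Proof.
have [_ _ [n [e [_ ->]]]] := S_order.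
move=> Ia [u Iu <-]; exists (fun k => a * u k).
  by move=> k; apply: integral_mul (Iu k).
by rewrite scaler_sumr; apply: eq_bigr => k _; rewrite scalerA.
Qed.

Lemma order_opp x : S x -> S (- x).
Proof.
by rewrite -scaleN1r; apply/order_scale/integral_opp/integral1.
Qed.

End Orders.

(** The determinant trick: multiplication by [x] on a generating family has coefficients in [O_L],
    so [x] is a root of a monic characteristic polynomial with integral coefficients. *)
Lemma order_integral (L : fieldExtType rat) (K : fieldExtType L) (S : set K) :
  is_order S -> S `<=` ring_of_integers K.
Proof.
move=> oS x Sx; have [S1 SM [n [e [e_span SE]]]] := oS.
have Se (k : 'I_n) : S e`_k.
  rewrite SE; exists (fun l => (l == k)%:R).
    by move=> l; apply: integral_nat.
  rewrite (bigD1 k) //= eqxx scale1r big1 ?addr0 // => l /negPf->.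
  by rewrite scale0r.
have /choice[a aE] (k : 'I_n) : exists a : 'I_n -> L,
    (forall l, ring_of_integers L (a l)) /\ x * e`_k = \sum_l a l *: e`_l.
  by have := SM _ _ Sx (Se k); rewrite {1}SE => -[a Ia <-]; exists a.
apply/integersP.
apply: (@integers_root _ (char_poly (\matrix_(l, k) (a k l)%:A : 'M[K]_n))).
- exact: char_poly_monic.
- apply: char_poly_over => l k; rewrite mxE integers_in_alg.
  by apply/integersP; case: (aE k).
rewrite -eigenvalue_root_char; apply/eigenvalueP.
(* The generators themselves form the eigenvector; even if dependent they span [1], so it is
   nonzero. *)
exists (\row_k e`_k).
  apply/rowP=> k; rewrite !mxE (aE k).2; apply: eq_bigr => l _.
  by rewrite !mxE mulrC -scalerAl mul1r.
apply/eqP=> /rowP e0.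
have : (1 : K) \in <<e>>%VS by rewrite e_span memvf.
move/coord_span=> /eqP; rewrite big1 ?oner_eq0 // => l _.
by have := e0 l; rewrite !mxE => ->; rewrite scaler0.
Qed.

(** * Quadratic orders and their conductors *)

Section QuadraticOrder.
Variables (L : fieldExtType rat) (K : fieldExtType L).
Hypothesis dimK : \dim {:K} = 2%N.
Variables (kappa : K) (B C : L).
Hypotheses (B_int : ring_of_integers L B) (C_int : ring_of_integers L C).
Hypothesis OK : ring_of_integers K = OL_adjoin kappa.
Hypothesis kappa_eq : kappa ^+ 2 + B%:A * kappa + C%:A = 0.
Variables (S : set K) (c : L).
Hypotheses (S_order : is_order S) (S_cond : has_conductor S c).

Lemma order_not_scalar : ~ (forall x, S x -> x \in <[1 : K]>%VS).
Proof.
move=> S_scal; have [S1 SM [n [e [e_span SE]]]] := S_order.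
suff : (\dim {:K} <= 1)%N by rewrite dimK.
rewrite -e_span; apply: (@leq_trans (\dim <[1 : K]>)); last first.
  by rewrite dim_vline oner_neq0.
apply/dimvS/span_subvP=> _ /(nthP 0)[k kn <-].
apply: S_scal; rewrite SE; rewrite size_tuple in kn.
exists (fun l => (l == Ordinal kn)%:R); first by move=> l; apply: integral_nat.
rewrite (bigD1 (Ordinal kn)) //= eqxx scale1r big1 ?addr0 // => l /negPf->.
by rewrite scale0r.
Qed.

Lemma OL_adjoin_quadratic x : ring_of_integers K x ->
  exists u v, [/\ ring_of_integers L u, ring_of_integers L v
    & x = u%:A + v%:A * kappa].
Proof.
rewrite OK => -[p /= Ip <-]; elim/poly_ind: p Ip => [|p a IHp] Ip.
  exists 0, 0; split; try exact: integral0.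
  by rewrite rmorph0 horner0 !scale0r mul0r addr0.
have [k|u [v [Iu Iv E]]] := IHp.
  by have := Ip k.+1; rewrite coefD coefMX coefC addr0.
have Ia : ring_of_integers L a.
  by have := Ip 0%N; rewrite coefD coefMX coefC add0r.
(* Horner step: [(u + v kappa) kappa + a], reduced by [kappa ^ 2 = - B kappa - C]. *)
exists (a - v * C), (u - v * B); split.
- by apply/integral_sub/integral_mul.
- by apply/integral_sub/integral_mul.
rewrite rmorphD rmorphM /= map_polyX map_polyC hornerMXaddC E /=.
have k2 : kappa * kappa = - (B%:A * kappa + C%:A).
  by apply/eqP; rewrite -addr_eq0 addrA -expr2 kappa_eq.
rewrite mulrDl -(mulrA v%:A) k2 !scalerBl !mulrBl -!scalerAl !mul1r -!scalerA.
rewrite scalerN scalerDr; ring.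
Qed.

(** If [u + v kappa] lies in [S], so does [v kappa]; then [v] lies in the conductor and is divisible
    by [c]. *)
Lemma order_conductor_decomposition x : S x ->
  exists u v, [/\ ring_of_integers L u, ring_of_integers L v
    & x = u%:A + v%:A * (c%:A * kappa)].
Proof.
move=> Sx; have [S1 SM _] := S_order.
have [u [v [Iu Iv xE]]] := OL_adjoin_quadratic (order_integral S_order Sx).
have Svk : S (v *: kappa).
  have -> : v *: kappa = x + - u%:A.
    by rewrite xE -scalerAl mul1r addrAC subrr add0r.
  by apply/(order_add S_order)/(order_opp S_order)/(order_scale S_order).
have : conductor S v%:A.
  move=> y /OL_adjoin_quadratic[s [t [Is It ->]]].
  rewrite -!scalerAl mul1r scalerDr mul1r; apply: (order_add S_order).
    rewrite scalerA; apply: (order_scale S_order) => //.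
    exact: integral_mul.
  by rewrite scalerA mulrC -scalerA; apply: (order_scale S_order).
(* The case [c = 0] must be treated here, since [conductor_neq0] is deduced from this lemma; there
   the conductor is zero, hence [v = 0]. *)
rewrite S_cond => -[z Iz vE]; have [c0|c0] := eqVneq c 0.
  exists u, 0; split => //; first exact: integral0.
  by rewrite xE -vE c0 !scale0r !mul0r.
exists u, (v / c); split => //.
  apply/integersP; rewrite -(integers_in_alg K); apply/integersP.
  suff -> : (v / c)%:A = z by [].
  rewrite mulrC -scalerA -vE -scalerAl mul1r scalerA mulVf // scale1r //.
by rewrite xE mulrA -[in RHS]scalerAl mul1r scalerA divfK.
Qed.

Lemma conductor_neq0 : c != 0.
Proof.
apply/eqP=> c0; apply: order_not_scalar => x.
move=> /order_conductor_decomposition[u [v [_ _ ->]]].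
by rewrite c0 scale0r mul0r mulr0 addr0 memvZ // memv_line.
Qed.

Lemma quadratic_generator_not_scalar : kappa \notin <[1 : K]>%VS.
Proof.
apply/negP=> /vlineP[s ks]; apply: order_not_scalar => x.
move=> /order_conductor_decomposition[u [v [_ _ ->]]].
by rewrite ks -!in_algE -!rmorphM -rmorphD /= memvZ // memv_line.
Qed.

End QuadraticOrder.

(** * Trace forms of quadratic extensions *)

Definition alg_norm (F : fieldType) (A : falgType F) (x : A) : F :=
  \det (mul_mx (vbasis {:A}) x).

Lemma alg_normE (F : fieldType) (A : falgType F) (e : (\dim {:A}).-tuple A) x :
  basis_of {:A} e -> alg_norm x = \det (mul_mx e x).
Proof. by move=> be; apply: det_mul_mx_basis (vbasisP _) be. Qed.

Lemma mul_mxZ (F : fieldType) (A : falgType F) n (e : n.-tuple A) a x :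
  mul_mx e (a *: x) = a *: mul_mx e x.
Proof. by apply/matrixP=> k l; rewrite !mxE -scalerAl linearZ. Qed.

Lemma mul_mxM (F : fieldType) (A : falgType F) n (e : n.-tuple A) x y :
  basis_of {:A} e -> mul_mx e (x * y) = mul_mx e y *m mul_mx e x.
Proof.
move=> be; apply/matrixP=> k l; rewrite !mxE -mulrA (mul_mxE y k be) mulr_sumr.
by rewrite linear_sum; apply: eq_bigr => j _; rewrite !mxE -scalerAr linearZ.
Qed.

Lemma alg_normM (F : fieldType) (A : falgType F) (x y : A) :
  alg_norm (x * y) = alg_norm x * alg_norm y.
Proof. by rewrite /alg_norm (mul_mxM _ _ (vbasisP _)) det_mulmx mulrC. Qed.

Lemma alg_norm1 (F : fieldType) (A : falgType F) : alg_norm (1 : A) = 1.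
Proof.
rewrite /alg_norm (_ : mul_mx _ _ = 1%:M) ?det1 //.
rewrite -(coord_mx1 (basis_free (vbasisP {:A}))).
by apply/matrixP=> k l; rewrite !mxE mul1r.
Qed.

Lemma alg_normZ (F : fieldType) (A : falgType F) a (x : A) :
  alg_norm (a *: x) = a ^+ \dim {:A} * alg_norm x.
Proof. by rewrite /alg_norm mul_mxZ detZ. Qed.

(** The determinant is multiplied by [(\det P) ^ 2], a nonzero integral square and so at least 1:
    this is the index formula for discriminants, as an inequality. *)
Lemma det_int_congr n m (P : 'M[int]_(n, m)) (A : 'M[rat]_m) : n = m ->
  \det (map_mx intr P *m A *m (map_mx intr P)^T) != 0 ->
  `|\det A| <= `|\det (map_mx intr P *m A *m (map_mx intr P)^T)|.
Proof.
move=> nm; subst m; rewrite !det_mulmx det_tr det_map_mx.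
set p := \det P; have [->|p0 _] := eqVneq p 0; first by rewrite !mul0r eqxx.
rewrite mulrAC normrM ler_peMl // normrM -intr_norm -intrM ler1z.
have p1 : 1 <= `|p| by rewrite -gtz0_ge1 normr_gt0.
exact: (le_trans p1 (ler_peMr _ p1)).
Qed.

Section QuadraticTrace.
Variables (L : fieldExtType rat) (K : fieldExtType L).
Hypothesis dimK : \dim {:K} = 2%N.
Variables (n : nat) (om : n.-tuple L).
Hypothesis om_basis : basis_of {:L} om.
Local Notation F := (baseFieldType K).

(** The tower basis over [rat] coming from [om] and [(1, y)]; its size is [n + n] so that block
    matrices apply. *)
Definition relative_tuple (y : K) : (n + n).-tuple F :=
  [tuple of [seq a%:A : F | a : L <- om] ++ [seq a *: y : F | a : L <- om]].

Lemma relative_tuple_l y (k : 'I_n) : (relative_tuple y)`_(lshift n k) = (om`_k)%:A.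
Proof.
by rewrite nth_cat size_map size_tuple /= ltn_ord (nth_map 0) ?size_tuple.
Qed.

Lemma relative_tuple_r y (k : 'I_n) : (relative_tuple y)`_(rshift n k) = om`_k *: y.
Proof.
rewrite nth_cat size_map size_tuple /= ltnNge leq_addr /= addKn (nth_map 0) //.
by rewrite size_tuple.
Qed.

Lemma relative_sum y (G : 'I_(n + n) -> rat) :
  \sum_k G k *: (relative_tuple y)`_k =
  (\sum_k G (lshift n k) *: om`_k) *: 1 + (\sum_k G (rshift n k) *: om`_k) *: y
  :> F.
Proof.
rewrite big_split_ord /= !scaler_suml; congr (_ + _); apply: eq_bigr => k _.
  by rewrite relative_tuple_l baseField_scaleE scalerA mulr_algl.
by rewrite relative_tuple_r baseField_scaleE scalerA mulr_algl.
Qed.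

Section Basis.
Variable y : K.
Hypothesis yN1 : y \notin <[1 : K]>%VS.

Lemma quadratic_eq0 (u v : L) : u%:A + v *: y = 0 -> u = 0 /\ v = 0.
Proof.
move=> uv0; have [v0|v0] := eqVneq v 0.
  move: uv0; rewrite v0 scale0r addr0 => /eqP.
  by rewrite scaler_eq0 oner_eq0 orbF => /eqP.
case/negP: yN1; apply/vlineP; exists (- (v^-1 * u)).
move/(congr1 (fun z => v^-1 *: z)): uv0.
rewrite scalerDr !scalerA mulVf // scale1r scaler0 => /eqP.
by rewrite addrC addr_eq0 -scaleNr => /eqP.
Qed.

Lemma quadratic_decomposition (x : K) : exists u v : L, x = u%:A + v *: y.
Proof.
have b1y : basis_of {:K} [tuple 1; y].
  rewrite basisEfree ?subvf ?dimK // andbT.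
  apply/freeP=> k; rewrite big_ord_recl big_ord1 /= => /quadratic_eq0[k0 k1].
  by case=> [[|[|//]] i]; [rewrite -[RHS]k0|rewrite -[RHS]k1]; congr k;
    apply: val_inj.
rewrite (coord_basis b1y (memvf x)) big_ord_recl big_ord1 /=.
by do 2!eexists.
Qed.

Lemma relative_basis : basis_of {:F} (relative_tuple y).
Proof.
apply/andP; split.
  rewrite eqEsubv subvf; apply/subvP=> x _.
  have [u [v ->]] := quadratic_decomposition x.
  pose G (k : 'I_(n + n)) := match split k with
    | inl k => coord om k u | inr k => coord om k v end.
  have Gu : \sum_k G (lshift n k) *: om`_k = u.
    rewrite [RHS](coord_basis om_basis (memvf u)).
    by apply: eq_bigr => k _; rewrite /G (unsplitK (inl _)).
  have Gv : \sum_k G (rshift n k) *: om`_k = v.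
    rewrite [RHS](coord_basis om_basis (memvf v)).
    by apply: eq_bigr => k _; rewrite /G (unsplitK (inr _)).
  rewrite -Gu -Gv -relative_sum.
  apply: rpred_sum => k _; rewrite rpredZ // memv_span // mem_nth //.
  by rewrite size_tuple.
apply/freeP=> G; rewrite relative_sum => /quadratic_eq0[u0 v0] k.
have /freeP om_free := basis_free om_basis.
rewrite -[k]splitK; case: (split k) => j /=.
  exact: (om_free (fun k => G (lshift n k))).
exact: (om_free (fun k => G (rshift n k))).
Qed.

End Basis.

Section Trace.
Variables (y : K) (q : L).
Hypotheses (yN1 : y \notin <[1 : K]>%VS) (y2 : y * y = q%:A).

(** On [L + L y] multiplication by [u + v y] has blocks [u, v] and [v q, u], because [y ^ 2 = q]
    lies in [L]; the two diagonal blocks give the factor 2. *)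
Lemma relative_trace (u v : L) :
  alg_trace (u%:A + v *: y : F) = 2%:R * alg_trace u.
Proof.
rewrite (alg_traceE _ (relative_basis yN1)).
rewrite (mul_mx_unique (M := block_mx (mul_mx om u) (mul_mx om v)
   (mul_mx om (v * q)) (mul_mx om u))).
- by rewrite mxtrace_block -(alg_traceE _ om_basis) mulr2n mulrDl !mul1r.
- exact: basis_free (relative_basis yN1).
move=> k; rewrite relative_sum -[k]splitK; case: (split k) => j /=.
  rewrite relative_tuple_l.
  under eq_bigr do rewrite block_mxEul.
  under [in X in _ = _ + X]eq_bigr do rewrite block_mxEur.
  rewrite -!(mul_mxE _ _ om_basis).
  (* The goal lives in [F], convertible to [K]; it is restated in [K], where scaling by [L] is
     available. *)
  suff : (u%:A + v *: y) * (om`_j)%:A = (u * om`_j)%:A + (v * om`_j) *: y :> K by [].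
  by rewrite mulrDl -!scalerAl mul1r -scalerAr mulr1 !scalerA.
rewrite relative_tuple_r.
under eq_bigr do rewrite block_mxEdl.
under [in X in _ = _ + X]eq_bigr do rewrite block_mxEdr.
rewrite -!(mul_mxE _ _ om_basis).
suff : (u%:A + v *: y) * (om`_j *: y) =
    (v * q * om`_j)%:A + (u * om`_j) *: y :> K by [].
rewrite mulrDl -!scalerAl mul1r -scalerAr y2 !scalerA addrC.
by rewrite mulrAC.
Qed.

Lemma relative_trace_form :
  trace_form (relative_tuple y) =
  block_mx (2%:R *: trace_form om) 0 0 (2%:R *: (mul_mx om q *m trace_form om)).
Proof.
have tr1 (u : L) : alg_trace (u%:A : F) = 2%:R * alg_trace u.
  by rewrite -(relative_trace u 0) scale0r addr0.
have try (v : L) : alg_trace (v *: y : F) = 0.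
  rewrite -[RHS](mulr0 2%:R) -[0 in RHS](mul0r (alg_trace (1 : L))).
  rewrite -alg_traceZ scale0r.
  by rewrite -(relative_trace 0 v) scale0r add0r.
apply/matrixP=> k l; rewrite [LHS]mxE -[k]splitK -[l]splitK.
case: (split k) => i; case: (split l) => j /=.
- rewrite block_mxEul !relative_tuple_l.
  have -> : (om`_i)%:A * (om`_j)%:A = (om`_i * om`_j)%:A :> F.
    by rewrite -in_algE -rmorphM.
  by rewrite tr1 !mxE.
- rewrite block_mxEur relative_tuple_l relative_tuple_r.
  have -> : (om`_i)%:A * (om`_j *: y) = (om`_i * om`_j) *: y :> F.
    suff : (om`_i)%:A * (om`_j *: y) = (om`_i * om`_j) *: y :> K by [].
    by rewrite mulr_algl scalerA.
  by rewrite try !mxE.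
- rewrite block_mxEdl relative_tuple_l relative_tuple_r.
  have -> : (om`_i *: y) * (om`_j)%:A = (om`_j * om`_i) *: y :> F.
    suff : (om`_i *: y) * (om`_j)%:A = (om`_j * om`_i) *: y :> K by [].
    by rewrite mulr_algr scalerA.
  by rewrite try !mxE.
rewrite block_mxEdr !relative_tuple_r.
have -> : (om`_i *: y) * (om`_j *: y) = (q * (om`_i * om`_j))%:A :> F.
  suff : (om`_i *: y) * (om`_j *: y) = (q * (om`_i * om`_j))%:A :> K by [].
  by rewrite -scalerAl -scalerAr y2 !scalerA mulrC.
by rewrite tr1 -trace_form_scaled // !mxE.
Qed.

(** The tower formula for discriminants: [4 q] is the relative discriminant of [(1, y)], and [1] and
    [y] span orthogonal blocks. *)
Lemma det_relative_trace_form :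
  \det (trace_form (relative_tuple y)) =
  \det (mul_mx om (4%:R *: q)) * \det (trace_form om) ^+ 2.
Proof.
rewrite relative_trace_form det_lblock !detZ det_mulmx mul_mxZ detZ.
by rewrite (_ : 4%:R = 2%:R * 2%:R) ?exprMn //; ring.
Qed.

(** Translating [y] by [s] in [L] is a unipotent change of basis. Its matrix is rational, so [s] may
    be non-integral. *)
Lemma det_relative_trace_form_shift (s : L) :
  \det (trace_form (relative_tuple (y - s%:A))) =
  \det (mul_mx om (4%:R *: q)) * \det (trace_form om) ^+ 2.
Proof.
rewrite (trace_form_congr (w := relative_tuple y)
  (P := block_mx 1%:M 0 (- mul_mx om s) 1%:M)).
  by rewrite !det_mulmx det_tr det_lblock !det1 !mul1r mulr1 det_relative_trace_form.
move=> k; rewrite relative_sum -[k]splitK; case: (split k) => j /=.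
  rewrite relative_tuple_l.
  under eq_bigr do rewrite block_mxEul.
  under [in X in _ = _ + X]eq_bigr do rewrite block_mxEur.
  rewrite (bigD1 j) //= mxE eqxx scale1r big1 => [|l /negPf lj]; last first.
    by rewrite mxE eq_sym lj scale0r.
  by rewrite addr0 big1 ?scale0r ?addr0 // => l _; rewrite mxE scale0r.
rewrite relative_tuple_r.
under eq_bigr do rewrite block_mxEdl mxE scaleNr.
under [in X in _ = _ + X]eq_bigr do rewrite block_mxEdr.
rewrite sumrN -(mul_mxE _ _ om_basis) (bigD1 j) //= mxE eqxx scale1r.
rewrite big1 => [|l /negPf lj]; last by rewrite mxE eq_sym lj scale0r.
by rewrite addr0 scalerBr scalerA scaleNr addrC mulrC.
Qed.

End Trace.
End QuadraticTrace.

(** * Discriminants and indices *)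

Lemma abs_disc_gt0 (F : fieldExtType rat) (S : set F) d : is_abs_disc S d -> 0 < d.
Proof.
case=> e [be _ ->]; rewrite normr_gt0.
exact: det_trace_form_neq0 be.
Qed.

Lemma quadratic_disc_lower_bound (L : fieldExtType rat) (K : fieldExtType L)
    (kappa : K) (B C c : L) (S : set K) (disc discL : rat) :
    \dim {:K} = 2%N ->
    ring_of_integers L B -> ring_of_integers L C ->
    ring_of_integers K = OL_adjoin kappa ->
    kappa ^+ 2 + B%:A * kappa + C%:A = 0 ->
    is_order S -> has_conductor S c ->
    is_abs_disc (S : set (baseFieldType K)) disc ->
    is_abs_disc (ring_of_integers L) discL ->
  `|alg_norm (c ^+ 2 * (B ^+ 2 - 4%:R * C))| * discL ^+ 2 <= disc.
Proof.
move=> dimK IB IC OK kappaE oS cS [e [be SE dE]] [om [bom OE dLE]].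
have c0 := conductor_neq0 dimK IB IC OK kappaE oS cS.
have kN1 := quadratic_generator_not_scalar dimK IB IC OK kappaE oS cS.
(* Completing the square: with [s = c B / 2], [c kappa = y - s] where [y] has square [q] in [L], and
   [4 q = c ^ 2 (B ^ 2 - 4 C)]. *)
have [s sE] : exists s, c * B = s + s.
  by exists (c * B / 2%:R); field; exact: (number_field_natr_neq0 L 1).
pose y := c *: kappa + s%:A.
have yN1 : y \notin <[1 : K]>%VS.
  apply: contra kN1 => /vlineP[t ty]; apply/vlineP; exists (c^-1 * (t - s)).
  by rewrite -scalerA scalerBl -ty /y addrK scalerA mulVf ?scale1r.
pose q := c ^+ 2 * (B ^+ 2 - 4%:R * C) / 4%:R.
have y2 : y * y = q%:A.
  have gZ a (x : K) : a *: x = in_alg K a * x by rewrite mulr_algl.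
  have gsE : in_alg K c * in_alg K B = in_alg K s + in_alg K s.
    by rewrite -rmorphM -rmorphD sE.
  have -> : q = s ^+ 2 - c ^+ 2 * C.
    have -> : s = c * B / 2%:R.
      by rewrite sE; field; exact: (number_field_natr_neq0 L 1).
    rewrite /q; field.
    by rewrite (number_field_natr_neq0 L 1) (number_field_natr_neq0 L 3).
  rewrite /y gZ -!in_algE rmorphB rmorphXn rmorphM rmorphXn.
  (* [y ^ 2] is rearranged so that the equation of [kappa] and the relation [2 s = c B] appear as
     factors that vanish. *)
  transitivity (in_alg K c ^+ 2 * (kappa ^+ 2 + in_alg K B * kappa + in_alg K C)
    + in_alg K c * kappa * (in_alg K s + in_alg K s - in_alg K c * in_alg K B)
    + in_alg K s ^+ 2 - in_alg K c ^+ 2 * in_alg K C); first by ring.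
  rewrite -!in_algE in kappaE; by rewrite kappaE gsE subrr !mulr0 !add0r.
(* [P] expresses the integral basis of [S] in the lattice [O_L + c kappa O_L], where [c kappa] is
   written [y - s]. *)
have [P eP] : exists P :
      'M[int]_(\dim {:baseFieldType K}, \dim {:L} + \dim {:L}),
    forall k : 'I_(\dim {:baseFieldType K}), e`_k =
      \sum_l (map_mx intr P) k l *: (relative_tuple om (y - s%:A))`_l.
  have Z_om x : ring_of_integers L x -> exists z : 'I_(\dim {:L}) -> int,
      x = \sum_l (z l)%:~R *: om`_l.
    rewrite OE => -[z _ <-]; exists z; apply: eq_bigr => l _.
    by rewrite scaler_int.
  have /choice[P eP] (k : 'I_(\dim {:baseFieldType K})) :
      exists z : 'I_(\dim {:L} + \dim {:L}) -> int, e`_k =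
      \sum_l (z l)%:~R *: (relative_tuple om (y - s%:A))`_l.
    have Sek : S e`_k.
      rewrite [S]SE; exists (fun l => (l == k)%:R) => //.
      rewrite (bigD1 k) //= eqxx big1 ?addr0 // => l /negPf->.
      by rewrite mulr0z.
    have [u [v [/Z_om[zu uE] /Z_om[zv vE] ->]]] :=
      order_conductor_decomposition IB IC OK kappaE oS cS Sek.
    exists (fun l => match split l with inl l => zu l | inr l => zv l end).
    rewrite (relative_sum _ _ (fun l => (match split l with
      inl l => zu l | inr l => zv l end)%:~R)).
    have -> : \sum_k0 (match split (lshift (\dim {:L}) k0) with
       inl l => zu l | inr l => zv l end)%:~R *: om`_k0 = u.
      by rewrite uE; apply: eq_bigr => l _; rewrite (unsplitK (inl _)).
    have -> : \sum_k0 (match split (rshift (\dim {:L}) k0) with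
       inl l => zu l | inr l => zv l end)%:~R *: om`_k0 = v.
      by rewrite vE; apply: eq_bigr => l _; rewrite (unsplitK (inr _)).
    rewrite /y addrK; suff : u%:A + v%:A * (c%:A * kappa) =
      u%:A + v *: (c *: kappa) :> K by [].
    by rewrite !mulr_algl.
  exists (\matrix_(k, l) P k l) => k; rewrite {1}eP; apply: eq_bigr => l _.
  by rewrite !mxE.
have sizes : \dim {:baseFieldType K} = (\dim {:L} + \dim {:L})%N.
  exact: size_basis (relative_basis dimK bom yN1).
have := det_int_congr (P := P)
  (A := trace_form (relative_tuple om (y - s%:A))) sizes.
rewrite -(trace_form_congr eP) (det_relative_trace_form_shift dimK bom yN1 y2).
move=> /(_ (det_trace_form_neq0 be)).
have -> : disc = `|\det (trace_form e)| := dE.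
have -> : discL = `|\det (trace_form om)| := dLE.
have -> : 4%:R *: q = c ^+ 2 * (B ^+ 2 - 4%:R * C).
  by rewrite scaler_nat -[LHS]mulr_natr divfK ?(number_field_natr_neq0 L 3).
by rewrite normrM normrX -(alg_normE _ bom).
Qed.

(** [D O_L] lies in [I], and the Smith form of multiplication by [D] identifies [O_L / D O_L] with a
    product of cyclic groups of total order [|N(D)|]; the representatives modulo [I] inject into
    it. *)
Lemma index_le_norm (L : fieldExtType rat) (dL : rat) (I : set L) (N : nat) (D : L) :
    is_abs_disc (ring_of_integers L) dL -> OL_submodule I ->
    is_ideal_norm I N -> I D -> ring_of_integers L D -> D != 0 ->
  N%:R <= `|alg_norm D|.
Proof.
case=> om [bom OE _] [I0 ID IM] [r Ir r_uniq] D_I D_int D0.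
set n := \dim {:L} in om bom OE *.
have Z_om x : ring_of_integers L x -> exists z : 'rV[int]_n,
    x = \sum_l (z 0 l)%:~R *: om`_l.
  rewrite OE => -[z _ <-]; exists (\row_l z l); apply: eq_bigr => l _.
  by rewrite scaler_int mxE.
have om_int (k : 'I_n) : ring_of_integers L om`_k.
  rewrite OE; exists (fun l => (l == k)%:R) => //.
  rewrite (bigD1 k) //= eqxx big1 ?addr0 // => l /negPf->.
  by rewrite mulr0z.
have /choice[Z rE] k := Z_om _ (Ir k).
have /choice[M DomE] k := Z_om _ (integral_mul D_int (om_int k)).
pose Mz : 'M[int]_n := \matrix_k M k.
have MzE : mul_mx om D = map_mx intr Mz.
  apply: mul_mx_unique; first exact: basis_free bom.
  by move=> k; rewrite DomE; apply: eq_bigr => l _; rewrite !mxE.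
have normD : `|alg_norm D| = `|\det Mz|%:~R.
  by rewrite (alg_normE _ bom) MzE det_map_mx /= -intr_norm.
have [Lm uL [Rm uR [ds _ MzS]]] := int_Smith_normal_form Mz.
set Dm := \matrix_(_, _) _ in MzS.
have unit_norm (U : 'M[int]_n) : U \in unitmx -> `|\det U| = 1.
  by rewrite unitmxE; case/orP=> /eqP->.
have Dm_det : `|\det Mz| = \prod_(l < n) `|ds`_l|.
  rewrite MzS !det_mulmx !normrM (unit_norm _ uL) (unit_norm _ uR) mul1r mulr1.
  rewrite (_ : Dm = diag_mx (\row_l ds`_l)); last first.
    by apply/matrixP=> k l; rewrite !mxE.
  by rewrite det_diag normr_prod; apply: eq_bigr => l _; rewrite mxE.
(* [N(D) N(1 / D) = 1]; hence all elementary divisors are nonzero and the residues below are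
   bounded. *)
have detM0 : \det Mz != 0.
  move: (alg_normM D D^-1); rewrite mulfV // alg_norm1 => /esym/eqP.
  apply: contraTneq => M0; move/eqP: normD; rewrite M0 normr0 normr_eq0.
  by move/eqP->; rewrite mul0r eq_sym oner_eq0.
have ds0 (l : 'I_n) : ds`_l != 0.
  apply: contra_neq detM0 => dl; apply/eqP; rewrite -normr_eq0 Dm_det.
  by rewrite (bigD1 l) //= dl normr0 mul0r.
(* Multiples of [D] are the integral row span of [Mz = Lm Dm Rm]; as [Lm] is unimodular, membership
   after multiplying by [invmx Rm] is divisibility by [ds] coordinate by coordinate. *)
pose V k := Z k *m invmx Rm.
pose m (l : 'I_n) := absz ds`_l.
pose v k (l : 'I_n) : nat := absz (modz (V k 0 l) ds`_l).
have lt_mod k l : (v k l < m l)%N.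
  by rewrite -ltz_nat !abszE ger0_norm ?modz_ge0 // ltz_mod.
pose f k : {dffun forall l : 'I_n, 'I_(m l)} :=
  [ffun l => Ordinal (lt_mod k l)].
(* Equal residues put [r k - r k'] in [D O_L], hence in [I], and representatives are unique. *)
have f_inj : injective f.
  move=> k k' /ffunP fkk'.
  have /choice[t tE] (l : 'I_n) : exists t : int, V k 0 l - V k' 0 l = t * ds`_l.
    have := fkk' l; rewrite !ffunE => /(congr1 val) /= /(congr1 Posz).
    rewrite !abszE !ger0_norm ?modz_ge0 // => /eqP.
    by rewrite eqz_mod_dvd => /dvdzP.
  have ZE : Z k - Z k' = (\row_l t l *m invmx Lm) *m Mz.
    rewrite MzS !mulmxA mulmxKV //.
    rewrite -[LHS](mulmxKV uR) ; congr (_ *m _).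
    apply/rowP=> l; rewrite mulmxBl; rewrite [LHS]mxE [X in _ + X]mxE tE mxE.
    rewrite (bigD1 l) //= !mxE eqxx mulr1n big1 ?addr0 // => j /negPf jl.
    by rewrite !mxE (jl : (j == l :> nat) = false) mulr0n mulr0.
  have Irr : I (r k - r k').
    move: (\row_l t l *m invmx Lm) ZE => u ZE.
    suff -> : r k - r k' = (\sum_l (u 0 l)%:~R *: om`_l) * D.
      apply: IM => //; rewrite OE; exists (u 0) => //.
      by apply: eq_bigr => l _; rewrite scaler_int.
    transitivity (\sum_l ((Z k - Z k') 0 l)%:~R *: om`_l).
      rewrite !rE -sumrB; apply: eq_bigr => l _.
      by rewrite !mxE intrB scalerBl.
    rewrite ZE mulr_suml.
    transitivity (\sum_l \sum_j (u 0 j * M j 0 l)%:~R *: om`_l).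
      apply: eq_bigr => l _; rewrite mxE -scaler_suml; congr (_ *: _).
      by rewrite rmorph_sum; apply: eq_bigr => j _; rewrite mxE.
    rewrite exchange_big; apply: eq_bigr => j _ /=.
    rewrite -scalerAl mulrC DomE scaler_sumr; apply: eq_bigr => l _.
    by rewrite scalerA intrM.
  have [k0 [_ k0_uniq]] := r_uniq _ (Ir k).
  by rewrite -(k0_uniq k) ?subrr // -(k0_uniq k').
have := leq_card f f_inj.
rewrite card_ord card_dep_ffun foldrE big_image /= => NL.
have PE : \prod_(l < n) `|ds`_l| = (\prod_(l < n) m l)%N%:Z.
  by rewrite (big_morph Posz PoszM (erefl 1%:Z)).
rewrite normD Dm_det PE -pmulrn ler_nat.
by move: NL; rewrite (eq_bigr m) // => l _; apply: card_ord.
Qed.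

(** * Real embeddings *)

Lemma embed_scale (F : fieldExtType rat) (E : numFieldType)
  (f : {rmorphism F -> E}) (a : rat) x : f (a *: x) = ratr a * f x.
Proof.
rewrite -mulr_algl rmorphM; congr (_ * _).
exact: (fmorph_eq_rat (f \o in_alg F) a).
Qed.

Lemma rmorphism_of_morphism (A B : nzRingType) (f : A -> B) :
  zmod_morphism f -> monoid_morphism f -> exists g : {rmorphism A -> B}, g =1 f.
Proof.
move=> fB fM.
pose fA := GRing.isZmodMorphism.Build A B f fB.
pose fR := GRing.isMonoidMorphism.Build A B f fM.
by exists (HB.pack f fA fR : {rmorphism A -> B}).
Qed.

(** Characteristic zero gives separability. The minimal polynomial is descended to [{poly rat}] so
    that its roots can be taken in [R[i]]. *)
Lemma primitive_element (F : fieldExtType rat) : exists (t : F) (p : {poly rat}),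
  [/\ p \is monic, size p = (\dim {:F}).+1, separable_poly p,
      (forall q, (map_poly (in_alg F) q).[t] = 0 -> p %| q)
    & (map_poly (in_alg F) p).[t] = 0
      /\ forall x, exists q : {poly rat}, x = (map_poly (in_alg F) q).[t]].
Proof.
have char0 : [pchar F] =i pred0.
  move=> n; rewrite !inE; apply/negP=> /andP[].
  by case: n => // n _ /=; rewrite (negPf (number_field_natr_neq0 F n)).
have sep : separable 1 {:F}.
  by apply/separableP=> y _; apply: pcharf0_separable.
set t := separable_generator 1 {:F}.
have Ft : {:F}%VS = <<1; t>>%VS.
  by rewrite {1}(eq_adjoin_separable_generator sep (subvf _)).
have /polyOver1P[p pE] := minPolyOver 1 t.
exists t, p; split.
- by have := monic_minPoly 1 t; rewrite pE map_monic.
- have := size_minPoly 1 t; rewrite pE size_map_poly => ->.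
  by rewrite Ft dim_Fadjoin dimv1 muln1.
- rewrite -(separable_map (in_alg F)) -pE.
  exact: (@pcharf0_separable _ _ 1%AS char0 t).
- move=> q qt; rewrite -(dvdp_map (in_alg F)) -pE; apply: minPoly_dvdp.
    by apply/polyOver1P; exists q.
  exact/rootP.
split; first by rewrite -pE minPolyxx.
move=> x; have /polyOver1P[q qE] := Fadjoin_polyOver 1 t x.
by exists q; rewrite -qE Fadjoin_poly_eq // -Ft memvf.
Qed.

Section Embeddings.
Variables (R : realType) (L : fieldExtType rat).

(** The map is [q(t) |-> q(z)]. The representing polynomial is chosen arbitrarily; [fE] shows
    independence of the choice, as two representatives differ by a multiple of [p]. *)
Lemma complex_embedding (t : L) (p : {poly rat}) (z : R[i]) :
    (forall q, (map_poly (in_alg L) q).[t] = 0 -> p %| q) ->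
    (forall x, exists q : {poly rat}, x = (map_poly (in_alg L) q).[t]) ->
    root (map_poly ratr p) z ->
  exists f : {rmorphism L -> R[i]}, f t = z.
Proof.
move=> p_dvd /choice[q qE] /rootP pz.
pose f x := (map_poly ratr (q x)).[z].
have fE r : (map_poly ratr r).[z] = f (map_poly (in_alg L) r).[t].
  apply/eqP; rewrite -subr_eq0 -hornerN -hornerD -rmorphN -rmorphD /=.
  have /dvdpP[s ->] : p %| r - q (map_poly (in_alg L) r).[t].
    by apply: p_dvd; rewrite rmorphB hornerD hornerN -qE subrr.
  by rewrite rmorphM hornerM pz mulr0.
have [||g gE] := @rmorphism_of_morphism L R[i] f.
- move=> x y; rewrite [in LHS](qE x) [in LHS](qE y) -hornerN -hornerD -rmorphB.
  by rewrite -fE rmorphB hornerD hornerN.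
- split.
    by have := fE 1%:P; rewrite !map_polyC !hornerC /= rmorph1 scale1r => <-.
  move=> x y; rewrite [in LHS](qE x) [in LHS](qE y) -hornerM -rmorphM.
  by rewrite -fE rmorphM hornerM.
by exists g; have := fE 'X; rewrite gE !map_polyX !hornerX.
Qed.

Hypothesis L_real : totally_real R L.

Lemma real_embedding (f : {rmorphism L -> R[i]}) :
  exists g : {rmorphism L -> R}, forall x, f x = (g x)%:C%C.
Proof.
pose h x := complex.Re (f x).
have fE x : f x = (h x)%:C%C by rewrite /h RRe_real.
have [||g gE] := @rmorphism_of_morphism L R h.
- by move=> x y; apply: complexI; rewrite [RHS]rmorphB /= -!fE rmorphB.
- split; first by apply: complexI; rewrite -fE rmorph1.
  by move=> x y; apply: complexI; rewrite [RHS]rmorphM /= -!fE rmorphM.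
by exists g => x; rewrite gE.
Qed.

(** The matrix [V] of conjugates of a basis diagonalizes every multiplication matrix, with the
    conjugates of [x] as eigenvalues. *)
Lemma real_embeddings_norm : exists f : 'I_(\dim {:L}) -> {rmorphism L -> R},
  forall x, ratr (alg_norm x) = \prod_k f k x.
Proof.
have [t [p [p_monic p_size p_sep p_dvd [pt p_gen]]]] := primitive_element L.
have [rs] := closed_field_poly_normal (map_poly ratr p : {poly R[i]}).
rewrite lead_coef_map (monicP p_monic) rmorph1 scale1r => rsE.
have size_rs : size rs = \dim {:L}.
  apply/succn_inj; rewrite -p_size.
  rewrite -(size_map_poly (ratr : {rmorphism rat -> R[i]})) rsE.
  by rewrite size_prod_XsubC.
have rs_uniq : uniq rs by rewrite -separable_prod_XsubC -rsE separable_map.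
have /choice[f fE] (k : 'I_(\dim {:L})) :
    exists g : {rmorphism L -> R}, (g t)%:C%C = rs`_k.
  have [|h ht] := @complex_embedding t p rs`_k p_dvd p_gen.
    by rewrite rsE root_prod_XsubC mem_nth // size_rs.
  by have [g gE] := real_embedding h; exists g; rewrite -gE.
exists f => x; set n := \dim {:L} in f fE *; set e := vbasis {:L}.
pose V : 'M[R]_n := \matrix_(k, l) f l e`_k.
have V0 : \det V != 0.
  (* The Vandermonde matrix of the conjugates of [t], distinct by separability, factors through
     [V]. *)
  have : \det (Vandermonde n (\row_l f l t)) != 0.
    rewrite det_Vandermonde; apply/prodf_neq0 => i _; apply/prodf_neq0 => j ij.
    rewrite !mxE subr_eq0; apply: contraTneq ij => /(congr1 (real_complex R)).
    rewrite /= !fE => /eqP; rewrite nth_uniq ?size_rs // => /eqP->.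
    by rewrite ltnn.
  rewrite (_ : Vandermonde _ _ =
    (\matrix_(j, k) ratr (coord e k (t ^+ j))) *m V).
    by rewrite det_mulmx mulf_eq0 negb_or => /andP[].
  apply/matrixP=> j l; rewrite !mxE -rmorphXn.
  rewrite [in LHS](coord_vbasis (memvf (t ^+ j))) rmorph_sum.
  by apply: eq_bigr => k _; rewrite embed_scale !mxE.
have VE : map_mx ratr (mul_mx e x) *m V = V *m diag_mx (\row_l f l x).
  apply/matrixP=> k l; rewrite mul_mx_diag [LHS]mxE [RHS]mxE [V k l]mxE [_ 0 l]mxE.
  rewrite mulrC -rmorphM (mul_mxE x k (vbasisP _)) rmorph_sum.
  by apply: eq_bigr => j _; rewrite embed_scale !mxE.
apply: (mulIf V0); rewrite /alg_norm -det_map_mx -det_mulmx VE det_mulmx det_diag.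
by rewrite mulrC; congr (_ * _); apply: eq_bigr => k _; rewrite mxE.
Qed.

End Embeddings.

(** * Quaternion algebras *)

Lemma det_mx2 (A : comNzRingType) (M : 'M[A]_2) :
  \det M = M 0 0 * M 1 1 - M 0 1 * M 1 0.
Proof.
rewrite (expand_det_row _ 0) !big_ord_recl big_ord0 addr0 /cofactor !det_mx11.
rewrite !mxE /= expr0 expr1 mul1r mulN1r mulrN.
by congr (M _ _ * M _ _ - M _ _ * M _ _); apply: val_inj.
Qed.

Section QuaternionCoordinates.
Variables (L : fieldExtType rat) (B : falgType L) (i j : B) (a b : L).
Hypothesis B_quat : is_quaternion i j a b.
Local Notation q := (coord (qbasis i j)).

Definition qelt (s x y z : L) : B := s *: 1 + x *: i + y *: j + z *: (i * j).

Lemma qbasis_basis : basis_of {:B} (qbasis i j).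
Proof. by case: B_quat => [[]]. Qed.

Lemma qbasis_coord (k l : 'I_4) : q k (qbasis i j)`_l = (k == l)%:R.
Proof. by rewrite coord_free 1?eq_sym // (basis_free qbasis_basis). Qed.

Lemma qcoord_qelt (k : 'I_4) s x y z :
  q k (qelt s x y z) = s * (k == 0)%:R + x * (k == 1)%:R
    + y * (k == 2%:R)%:R + z * (k == 3%:R)%:R.
Proof.
rewrite /qelt !linearD !linearZ /=.
by rewrite -(qbasis_coord k 0) -(qbasis_coord k 1) -(qbasis_coord k 2%:R)
  -(qbasis_coord k 3%:R).
Qed.

Lemma qeltK x : x = qelt (q 0 x) (q 1 x) (q 2%:R x) (q 3%:R x).
Proof.
rewrite {1}(coord_basis qbasis_basis (memvf x)) !big_ord_recl big_ord0 addr0.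
rewrite /qelt !addrA; congr (_ *: _ + _ *: _ + _ *: _ + _ *: _);
  by congr (coord _ _ _); apply: val_inj.
Qed.

(** With this multiplication table, later identities in [B] become polynomial identities over [L]
    for [ring]. *)
Lemma qeltM s x y z s' x' y' z' :
  qelt s x y z * qelt s' x' y' z' =
  qelt (s * s' + a * x * x' + b * y * y' - a * b * z * z')
       (s * x' + x * s' - b * y * z' + b * z * y')
       (s * y' + y * s' + a * x * z' - a * z * x')
       (s * z' + z * s' + x * y' - y * x').
Proof.
have [[_ _ _] [ii jj ji]] := B_quat.
have i_ij : i * (i * j) = a *: j by rewrite mulrA ii -scalerAl mul1r.
have ij_j : i * j * j = b *: i by rewrite -mulrA jj -scalerAr mulr1.
have ij_i : i * j * i = - (a *: j) by rewrite -mulrA ji mulrN i_ij.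
have j_ij : j * (i * j) = - (b *: i) by rewrite mulrA ji mulNr ij_j.
have ij_ij : i * j * (i * j) = - ((a * b) *: 1).
  by rewrite mulrA ij_i mulNr -scalerAl jj scalerA.
apply: (can_inj (g := fun v : 'I_4 -> L => \sum_k v k *: (qbasis i j)`_k)
  (f := fun x k => q k x)).
  by move=> t; rewrite -(coord_basis qbasis_basis (memvf t)).
apply/funext=> k; rewrite qcoord_qelt /qelt !mulrDl !mulrDr.
rewrite -!scalerAl -!scalerAr !mul1r !mulr1 ii jj ji i_ij ij_j ij_i j_ij ij_ij.
rewrite !scalerN !linearD !linearN !linearZ /=.
have := qbasis_coord k 0; have := qbasis_coord k 1.
have := qbasis_coord k 2%:R; have := qbasis_coord k 3%:R => /= -> -> -> ->.
ring.
Qed.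

Lemma Trd_qelt s x y z : Trd i j (qelt s x y z) = 2%:R * s.
Proof.
rewrite /Trd /qconj !qcoord_qelt /= !mulr0 !mulr1 !addr0 !add0r.
rewrite linearD !linearB !linearZ /= qcoord_qelt.
have := qbasis_coord 0 0; have := qbasis_coord 0 1.
have := qbasis_coord 0 2%:R; have := qbasis_coord 0 3%:R => /= -> -> -> ->.
rewrite /=; ring.
Qed.

Lemma Nrd_qelt s x y z :
  Nrd i j (qelt s x y z) = s ^+ 2 - a * x ^+ 2 - b * y ^+ 2 + a * b * z ^+ 2.
Proof.
rewrite /Nrd /qconj !qcoord_qelt /= !mulr0 !mulr1 !addr0 !add0r.
have -> : s *: 1 - x *: i - y *: j - z *: (i * j) = qelt s (- x) (- y) (- z).
  by rewrite /qelt !scaleNr.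
rewrite qeltM qcoord_qelt /=; ring.
Qed.

Lemma qelt1 : 1 = qelt 1 0 0 0.
Proof. by rewrite /qelt scale1r !scale0r !addr0. Qed.

(** For [x = s + p] with [p] pure, the pure part of [x ^ 2] is [2 s p]; if [s] were nonzero, [p]
    would vanish and [x] would be scalar. *)
Lemma pure_of_sqr x n : x * x = n%:A -> x \notin <[1]>%VS -> q 0 x = 0.
Proof.
move=> x2; apply: contraNeq => s0; apply/vlineP; exists (q 0 x).
have nE : n%:A = qelt n 0 0 0 by rewrite /qelt !scale0r !addr0.
have two0 := number_field_natr_neq0 L 1.
have coord0 (k : 'I_4) : q k (x * x) = 2%:R * q 0 x * q k x -> k != 0 -> q k x = 0.
  rewrite x2 nE qcoord_qelt => E /negPf k0; apply/eqP.
  move/eqP: E; rewrite k0 !mul0r mulr0 !addr0 eq_sym !mulf_eq0.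
  by rewrite (negPf two0) (negPf s0).
have sqE := qeltM (q 0 x) (q 1 x) (q 2%:R x) (q 3%:R x)
  (q 0 x) (q 1 x) (q 2%:R x) (q 3%:R x).
rewrite -qeltK in sqE.
have scalarE u v w : u = 0 -> v = 0 -> w = 0 -> qelt (q 0 x) u v w = (q 0 x)%:A.
  by move=> -> -> ->; rewrite /qelt !scale0r !addr0.
rewrite [LHS]qeltK; apply: scalarE; apply: coord0 => //.
- by rewrite sqE qcoord_qelt /=; ring.
- by rewrite sqE qcoord_qelt /=; ring.
by rewrite sqE qcoord_qelt /=; ring.
Qed.

Section PurePair.
Variables x1 x2 x3 y1 y2 y3 : L.
Local Notation k1 := (qelt 0 x1 x2 x3).
Local Notation k2 := (qelt 0 y1 y2 y3).
Local Notation D := (4%:R * Nrd i j k1 * Nrd i j k2 - Trd i j (k1 * k2) ^+ 2).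

(** Products of an odd number of the [k_i] occurring here have trace zero, so [(1, k1 k2)] and
    [(k1, k2)] are orthogonal; their Gram determinants are [- D] and [D]. *)
Lemma det_pure_pair :
  \det (\matrix_(k < 4, l < 4) Trd i j
    ([:: 1; k1 * k2; k1; k2]`_k * [:: 1; k1 * k2; k1; k2]`_l)) = - D ^+ 2.
Proof.
set M := \matrix_(_, _) _; rewrite -[M](@submxK _ 2 2 2 2).
have -> : @ursubmx _ 2 2 2 2 M = 0.
  apply/matrixP=> -[[|[|//]] ?] [[|[|//]] ?];
    rewrite !mxE /= ?qelt1 !qeltM Trd_qelt; ring.
rewrite [LHS](@det_lblock _ 2 2) !det_mx2 !mxE /= qelt1 !qeltM !Trd_qelt.
rewrite !Nrd_qelt; ring.
Qed.

(** Lagrange's identity for the ternary form with coefficients [- a, - b, a b]: the Gram determinant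
    as a weighted sum of squared minors. *)
Lemma pure_pair_disc : D = 4%:R * (a * b * (x1 * y2 - x2 * y1) ^+ 2
  - a ^+ 2 * b * (x1 * y3 - x3 * y1) ^+ 2
  - a * b ^+ 2 * (x2 * y3 - x3 * y2) ^+ 2).
Proof. rewrite qeltM Trd_qelt !Nrd_qelt; ring. Qed.

Lemma pure_pair_parallel :
    k1 != 0 -> x1 * y2 - x2 * y1 = 0 -> x1 * y3 - x3 * y1 = 0 ->
    x2 * y3 - x3 * y2 = 0 ->
  exists t, k2 = t *: k1.
Proof.
move=> k10 /subr0_eq m12 /subr0_eq m13 /subr0_eq m23.
have scaleE t : t *: k1 = qelt 0 (t * x1) (t * x2) (t * x3).
  by rewrite /qelt !scalerDr !scalerA mulr0.
have solve (x u y v : L) : x != 0 -> x * v = u * y -> v = y / x * u.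
  by move=> x0 e; apply: (mulfI x0); rewrite e; field.
have [x10|x10] := eqVneq x1 0; last first.
  by exists (y1 / x1); rewrite scaleE -(solve x1 x1 y1 y1)
    -?(solve x1 x2 y1 y2) -?(solve x1 x3 y1 y3).
have [x20|x20] := eqVneq x2 0; last first.
  by exists (y2 / x2); rewrite scaleE -(solve x2 x1 y2 y1)
    -?(solve x2 x2 y2 y2) -?(solve x2 x3 y2 y3) // m12.
have [x30|x30] := eqVneq x3 0; last first.
  by exists (y3 / x3); rewrite scaleE -(solve x3 x1 y3 y1)
    -?(solve x3 x2 y3 y2) -?(solve x3 x3 y3 y3) // ?m13 ?m23.
by case/eqP: k10; rewrite /qelt x10 x20 x30 !scale0r !addr0.
Qed.

End PurePair.

(** * Definiteness at a real embedding *)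

Section Definite.
Variables (R : realType) (f : {rmorphism L -> R}).
Hypothesis f_div : ext_division (qbasis i j) f.

Lemma ext_one_qbasis (k : 'I_4) : ext_one (qbasis i j) f 0 k = (k == 0)%:R.
Proof.
by rewrite mxE [X in q _ X]qelt1 qcoord_qelt mul1r !mul0r !addr0 rmorph_nat.
Qed.

Lemma ord4_sum (V : nmodType) (G : 'I_4 -> V) :
  \sum_k G k = G 0 + G 1 + G 2%:R + G 3%:R.
Proof.
rewrite !big_ord_recl big_ord0 addr0 !addrA.
by congr (G _ + G _ + G _ + G _); apply: val_inj.
Qed.

(** The left factor is [e_l - s]; invertibility of this element becomes a linear system in the
    coordinates of [v]. *)
Lemma ext_mul_sub_scalar (l : 'I_4) (s : R) (v : 'rV[R]_4) (k : 'I_4) :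
  ext_mul (qbasis i j) f (\row_m ((m == l)%:R - s * (m == 0)%:R)) v 0 k =
  \sum_m v 0 m * f (q k ((qbasis i j)`_l * (qbasis i j)`_m)) - s * v 0 k.
Proof.
rewrite mxE; pose T (p : 'I_4) :=
  \sum_m v 0 m * f (q k ((qbasis i j)`_p * (qbasis i j)`_m)).
have -> : v 0 k = T 0.
  rewrite /T (bigD1 k) //= mul1r qbasis_coord eqxx rmorph1 mulr1 big1 ?addr0 //.
  by move=> m /negPf mk; rewrite mul1r qbasis_coord eq_sym mk rmorph0 mulr0.
transitivity (\sum_p ((p == l)%:R * T p - s * ((p == 0)%:R * T p))).
  apply: eq_bigr => p _; rewrite mxE mulrA -mulrBl mulr_sumr.
  by apply: eq_bigr => m _; rewrite mulrA.
rewrite sumrB -mulr_sumr; congr (_ - s * _).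
  by rewrite (bigD1 l) //= eqxx mul1r big1 ?addr0 // => p /negPf->; rewrite mul0r.
by rewrite (bigD1 0) //= mul1r big1 ?addr0 // => p /negPf->; rewrite mul0r.
Qed.

(* If f a = s^2, then i - s is a zero divisor of the extension, because
   (i - s)(i + s) = 0; likewise for b and j. *)
Lemma definite_neg : f a < 0 /\ f b < 0.
Proof.
have [_ [ii jj ji]] := B_quat; have [_ div] := f_div.
have unit_row (l : 'I_4) s : l != 0 ->
    exists v : 'rV[R]_4, forall k : 'I_4, \sum_m v 0 m *
      f (q k ((qbasis i j)`_l * (qbasis i j)`_m)) - s * v 0 k = (k == 0)%:R.
  move=> /negPf l0.
  have [|v [/rowP uv _]] := div (\row_m ((m == l)%:R - s * (m == 0)%:R)).
    apply/eqP=> /rowP/(_ l)/eqP.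
    by rewrite !mxE eqxx l0 mulr0 subr0 oner_eq0.
  by exists v => k; rewrite -ext_mul_sub_scalar uv ext_one_qbasis.
have c0 := qbasis_coord^~ 0; have c1 := qbasis_coord^~ 1.
have c2 := qbasis_coord^~ 2%:R; have c3 := qbasis_coord^~ 3%:R.
rewrite /= in c0 c1 c2 c3.
split; rewrite ltNge; apply/negP=> fpos.
  have [v uv] := unit_row 1 (Num.sqrt (f a)) isT.
  have ss : f a = Num.sqrt (f a) ^+ 2 by rewrite sqr_sqrtr.
  move: ss uv; set s := Num.sqrt _ => ss uv.
  have i_ij : i * (i * j) = a *: j by rewrite mulrA ii -scalerAl mul1r.
  have uvE k : v 0 0 * (k == 1)%:R + v 0 1 * (s ^+ 2 * (k == 0)%:R)
      + v 0 2%:R * (k == 3%:R)%:R + v 0 3%:R * (s ^+ 2 * (k == 2%:R)%:R)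
      - s * v 0 k = (k == 0)%:R.
    rewrite -[RHS]uv ord4_sum /= mulr1 ii i_ij !linearZ /= c0 c1 c2 c3 -ss.
    by rewrite !rmorphM !rmorph_nat.
  (* Coordinate 1 forces [v_0 = s v_1], after which coordinate 0 reads [0 = 1]. *)
  have := uvE 0; have := uvE 1; rewrite /= => e1 e0.
  have v01 : v 0 0 = s * v 0 1 by lra.
  by move: e0; rewrite v01; lra.
have [v uv] := unit_row 2%:R (Num.sqrt (f b)) isT.
have ss : f b = Num.sqrt (f b) ^+ 2 by rewrite sqr_sqrtr.
move: ss uv; set s := Num.sqrt _ => ss uv.
have j_ij : j * (i * j) = - (b *: i).
  by rewrite mulrA ji mulNr -mulrA jj -scalerAr mulr1.
have uvE k : v 0 0 * (k == 2%:R)%:R - v 0 1 * (k == 3%:R)%:R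
    + v 0 2%:R * (s ^+ 2 * (k == 0)%:R) - v 0 3%:R * (s ^+ 2 * (k == 1)%:R)
    - s * v 0 k = (k == 0)%:R.
  rewrite -[RHS]uv ord4_sum /= mulr1 ji jj j_ij !linearN !linearZ /= c0 c1 c2 c3 -ss.
  by rewrite !rmorphN !rmorphM !rmorph_nat !mulrN.
have := uvE 0; have := uvE 2%:R; rewrite /= => e2 e0.
have v02 : v 0 0 = s * v 0 2%:R by lra.
by move: e0; rewrite v02; lra.
Qed.

(** As [f a] and [f b] are negative, the three terms of Lagrange's identity are nonnegative; if
    [f D = 0], every minor vanishes. The upper bound drops the square of [f (Trd (k1 * k2))]. *)
Lemma definite_pure_pair x1 x2 x3 y1 y2 y3 :
  let k1 := qelt 0 x1 x2 x3 in let k2 := qelt 0 y1 y2 y3 in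
  let D := 4%:R * Nrd i j k1 * Nrd i j k2 - Trd i j (k1 * k2) ^+ 2 in
  [/\ 0 <= f D, f D <= 4%:R * f (Nrd i j k1) * f (Nrd i j k2)
    & f D = 0 -> k1 != 0 -> exists t, k2 = t *: k1].
Proof.
move=> k1 k2 D; have [fa fb] := definite_neg.
have DE : f D = 4%:R * (f a * f b * f (x1 * y2 - x2 * y1) ^+ 2
  - f a ^+ 2 * f b * f (x1 * y3 - x3 * y1) ^+ 2
  - f a * f b ^+ 2 * f (x2 * y3 - x3 * y2) ^+ 2).
  rewrite /D pure_pair_disc !(rmorphM, rmorphB, rmorphXn, rmorph_nat) //=.
set u := f (x1 * y2 - x2 * y1) in DE; set v := f (x1 * y3 - x3 * y1) in DE.
set w := f (x2 * y3 - x3 * y2) in DE.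
have fab : 0 < f a * f b by nra.
have u2 : 0 <= f a * f b * u ^+ 2 by rewrite mulr_ge0 ?sqr_ge0 // ltW.
have v2 : 0 <= - (f a ^+ 2 * f b * v ^+ 2).
  by rewrite -mulNr mulr_ge0 ?sqr_ge0 //; nra.
have w2 : 0 <= - (f a * f b ^+ 2 * w ^+ 2).
  by rewrite -mulNr mulr_ge0 ?sqr_ge0 //; nra.
split; first by rewrite DE; lra.
  rewrite /D rmorphB rmorphXn !rmorphM rmorph_nat lerBlDr lerDl; exact: sqr_ge0.
rewrite DE => D0 k10.
have u0 : f a * f b * u ^+ 2 = 0 by lra.
have v0 : f a ^+ 2 * f b * v ^+ 2 = 0 by lra.
have w0 : f a * f b ^+ 2 * w ^+ 2 = 0 by lra.
have fa0 : f a != 0 by rewrite lt_eqF.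
have fb0 : f b != 0 by rewrite lt_eqF.
apply: pure_pair_parallel => //; apply/eqP; rewrite -(fmorph_eq0 f).
- by move/eqP: u0; rewrite !(mulf_eq0, expf_eq0) (negPf fa0) (negPf fb0) /= ?orbb.
- by move/eqP: v0; rewrite !(mulf_eq0, expf_eq0) (negPf fa0) (negPf fb0) /= ?orbb.
by move/eqP: w0; rewrite !(mulf_eq0, expf_eq0) (negPf fa0) (negPf fb0) /= ?orbb.
Qed.

End Definite.

End QuaternionCoordinates.

(** * Principal ideals *)

Section Ideals.
Variables (R : realType) (L : fieldExtType rat).
Hypothesis L_cl1 : strict_class_number_one L R.

Lemma integral_ideal_principal (I : set L) x :
  integral_ideal I -> I x -> x != 0 -> exists t, I = principal t.
Proof.
move=> [I_sub I_int] Ix x0; have [|t _ It] := L_cl1 (I := I); last by exists t.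
split=> //.
  by move=> I0; case/eqP: x0; have := Ix; rewrite I0.
exists 1; first by split; [exact: integral1 | exact: oner_neq0].
by move=> y /I_int; rewrite mul1r.
Qed.

Lemma ideal_mul_principal (t s : L) :
  ideal_mul (principal t) (principal s) = principal (t * s).
Proof.
apply/seteqP; split=> x.
  move=> [n [u [v [tu sv ->]]]].
  have /choice[u' u'E] k : exists y, ring_of_integers L y /\ t * y = u k.
    by have [y Iy <-] := tu k; exists y.
  have /choice[v' v'E] k : exists y, ring_of_integers L y /\ s * y = v k.
    by have [y Iy <-] := sv k; exists y.
  exists (\sum_k u' k * v' k).
    apply/integersP/rpred_sum => k _; apply/rpredM; apply/integersP.
      by case: (u'E k).
    by case: (v'E k).
  rewrite mulr_sumr; apply: eq_bigr => k _.
  by rewrite -(u'E k).2 -(v'E k).2; ring.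
move=> [y Iy <-]; exists 1, (fun=> t), (fun=> s * y); split=> [_|_|].
- by exists 1; [exact: integral1 | rewrite mulr1].
- by exists y.
by rewrite big_ord1 mulrA.
Qed.

(** [x / t] has integral square, so it is integral, and it generates the cofactor ideal. *)
Lemma principal_sub_square (t x : L) :
    principal (t * t) (x ^+ 2) -> x != 0 ->
  principal t x /\ ideal_dvd (principal t) (principal x).
Proof.
move=> [y Iy yE] x0; have t0 : t != 0.
  by apply: contra_neq x0 => t0; apply/eqP; rewrite -sqrf_eq0 -yE t0 !mul0r.
have Ixt : ring_of_integers L (x / t).
  apply/integersP/integers_sqr/integersP.
  by rewrite expr_div_n -yE -expr2 mulrC mulKf // expf_neq0.
have tE : t * (x / t) = x by rewrite mulrC divfK.
split; first by exists (x / t).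
exists (principal (x / t)); last by rewrite ideal_mul_principal tE.
split; last by move=> _ [z Iz <-]; apply: integral_mul.
split.
- by exists 0; [exact: integral0 | rewrite mulr0].
- move=> _ _ [z Iz <-] [w Iw <-]; exists (z + w); first exact: integral_add.
  by rewrite mulrDr.
- move=> s _ Is [z Iz <-]; exists (s * z); first exact: integral_mul.
  by rewrite mulrCA.
Qed.

Lemma reduced_disc_dvd (B : falgType L) (i j : B) (O : set B) (d : set L) (D : L) :
    is_reduced_disc i j O d -> disc_ideal i j O (D ^+ 2) -> D != 0 ->
  d D /\ ideal_dvd d (principal D).
Proof.
move=> [d_int dd] D2 D0; rewrite -dd in D2.
(* [D ^ 2] is a nonzero sum of products from [d], so [d] is nonzero and has a generator. *)
have [x dx x0] : exists2 x, d x & x != 0.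
  have [n [u [v [du dv uvE]]]] := D2; apply: contrapT => d0.
  case/eqP: D0; apply/eqP; rewrite -sqrf_eq0 uvE big1 // => k _.
  have [->|uk] := eqVneq (u k) 0; first by rewrite mul0r.
  by case: d0; exists (u k).
have [t dE] := integral_ideal_principal d_int dx x0.
by rewrite dE ideal_mul_principal in D2 *; apply: principal_sub_square.
Qed.

End Ideals.

(** * The CM fields inside the quaternion algebra *)

Section EmbeddedGenerator.
Variables (L : fieldExtType rat) (K : fieldExtType L).
Hypothesis dimK : \dim {:K} = 2%N.
Variables (B : falgType L) (phi : {lrmorphism K -> B}).

Lemma embedding_notin_scalar (z : K) :
  z \notin <[1 : K]>%VS -> phi z \notin <[1 : B]>%VS.
Proof.
apply: contra => /vlineP[t tE]; apply/vlineP; exists t.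
have phi_t : phi t%:A = t%:A by rewrite linearZ rmorph1.
by apply: (fmorph_inj phi); apply: etrans tE (esym phi_t).
Qed.

Lemma embedding_sqr (z : K) (n : L) : z * z = n%:A -> phi z * phi z = n%:A.
Proof.
have phi_n : phi n%:A = n%:A by rewrite linearZ rmorph1.
by move=> zn; rewrite -rmorphM zn; apply: phi_n.
Qed.

Lemma embedding_range (z : K) : z \notin <[1 : K]>%VS ->
  range phi = [set x | exists u v : L, x = u%:A + v *: phi z].
Proof.
move=> zN1; apply/seteqP; split=> x /=.
  move=> [w _ <-]; have [u [v ->]] := quadratic_decomposition dimK zN1 w.
  by exists u, v; rewrite linearD !linearZ rmorph1.
move=> [u [v ->]]; exists (u%:A + v *: z) => //.
by rewrite linearD !linearZ rmorph1.
Qed.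

End EmbeddedGenerator.

(** [sqrt_m] is integral because its square is, and [c] lies in the conductor, which puts [z] in
    [S]. *)
Lemma quadratic_sqrt (L : fieldExtType rat) (K : fieldExtType L)
    (kappa sqrt_m : K) (B C m c : L) (S : set K) :
    \dim {:K} = 2%N ->
    ring_of_integers L B -> ring_of_integers L C ->
    ring_of_integers K = OL_adjoin kappa ->
    kappa ^+ 2 + B%:A * kappa + C%:A = 0 ->
    is_order S -> has_conductor S c ->
    - m = B ^+ 2 - 4%:R * C -> sqrt_m ^+ 2 = (- m)%:A ->
  let z := c%:A * sqrt_m in
  [/\ S z, z * z = (- (c ^+ 2 * m))%:A & z \notin <[1 : K]>%VS].
Proof.
move=> dimK IB IC OK kappaE oS cS mE sE z.
have c0 := conductor_neq0 dimK IB IC OK kappaE oS cS.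
have kN1 := quadratic_generator_not_scalar dimK IB IC OK kappaE oS cS.
split.
- have : conductor S c%:A.
    by rewrite cS; exists 1; [exact: integral1 | rewrite mulr1].
  apply; apply/integersP/integers_sqr; rewrite sE integers_in_alg mE.
  have IB' := introT (integersP _) IB; have IC' := introT (integersP _) IC.
  by rewrite rpredB ?rpredX ?rpredM ?rpred_nat.
- rewrite /z mulrACA -[sqrt_m * _]expr2 sE -!in_algE -!rmorphM.
  by congr (_ %:A); ring.
rewrite /z mulr_algl; apply: contra kN1 => /vlineP[t tE].
(* Hence [sqrt_m] is [2 kappa + B] up to sign; if it were scalar, [kappa] would be too. *)
have sqE : sqrt_m ^+ 2 = (2%:R * kappa + B%:A) ^+ 2.
  rewrite sE mE -!in_algE rmorphB rmorphXn rmorphM rmorph_nat.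
  rewrite -!in_algE in kappaE.
  apply/eqP; rewrite -subr_eq0; apply/eqP.
  transitivity (- 4%:R * (kappa ^+ 2 + in_alg K B * kappa + in_alg K C)).
    by ring.
  by rewrite kappaE mulr0.
have s_scal : sqrt_m \in <[1 : K]>%VS.
  apply/vlineP; exists (c^-1 * t).
  by rewrite -scalerA -tE scalerA mulVf // scale1r.
have k_scal : 2%:R *: kappa \in <[1 : K]>%VS.
  rewrite scaler_nat -mulr_natl -[X in X \in _](addrK B%:A) rpredB //.
    move/eqP: sqE; rewrite eqf_sqr => /orP[/eqP<-|/eqP sqE] //.
    by rewrite -[X in X \in _]opprK -sqE rpredN.
  by rewrite memvZ // memv_line.
move: k_scal => /(memvZ (2%:R^-1)).
by rewrite scalerA mulVf ?scale1r // (number_field_natr_neq0 L 1).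
Qed.

Lemma disc_ideal_pure_pair (L : fieldExtType rat) (B : falgType L) (i j : B)
    (a b : L) (O : set B) (k1 k2 : B) :
    is_quaternion i j a b -> is_order O -> O k1 -> O k2 ->
    coord (qbasis i j) 0 k1 = 0 -> coord (qbasis i j) 0 k2 = 0 ->
  disc_ideal i j O
    ((4%:R * Nrd i j k1 * Nrd i j k2 - Trd i j (k1 * k2) ^+ 2) ^+ 2).
Proof.
move=> Bq [O1 OM _] Ok1 Ok2 k1_pure k2_pure.
(* The coefficient [-1] of [O_L] absorbs the sign of the determinant [- D ^ 2]. *)
exists 1, (fun=> -1), (fun=> \det (\matrix_(k < 4, l < 4) Trd i j
    ([:: 1; k1 * k2; k1; k2]`_k * [:: 1; k1 * k2; k1; k2]`_l))); split.
- by move=> _; apply/integral_opp/integral1.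
- move=> _; exists (fun k : 'I_4 => [:: 1; k1 * k2; k1; k2]`_k) => //= k.
  by case: k => [[|[|[|[|//]]]] ?] //=; apply: OM.
rewrite big_ord1 (qeltK Bq k1) (qeltK Bq k2) k1_pure k2_pure.
by rewrite (det_pure_pair Bq) mulrN mulN1r opprK.
Qed.

Lemma Nrd_pure (L : fieldExtType rat) (B : falgType L) (i j : B) (a b n : L)
    (k : B) :
    is_quaternion i j a b -> coord (qbasis i j) 0 k = 0 -> k * k = (- n)%:A ->
  Nrd i j k = n.
Proof.
move=> Bq k_pure k2.
have nE : (- n)%:A = qelt i j (- n) 0 0 0 by rewrite /qelt !scale0r !addr0.
have := congr1 (coord (qbasis i j) 0) k2.
rewrite nE (qeltK Bq k) k_pure (qeltM Bq) !(qcoord_qelt Bq) (Nrd_qelt Bq) /=.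
by move=> nk; apply: oppr_inj; rewrite -[RHS]mulr1; rewrite !mulr0 !addr0 in nk;
  rewrite -nk; ring.
Qed.

Theorem theorem11p3 (R : realType) (g : nat) (L : fieldExtType rat)
  (L_deg : \dim {:L} = g)
  (L_real : totally_real R L)
  (L_cl1 : strict_class_number_one L R)
  (K1 K2 : fieldExtType L)
  (K1_CM : CM_over R K1) (K2_CM : CM_over R K2)
  (kappa1 : K1) (kappa2 : K2) (B1 C1 B2 C2 m1 m2 : L)
  (B1_int : ring_of_integers L B1) (C1_int : ring_of_integers L C1)
  (B2_int : ring_of_integers L B2) (C2_int : ring_of_integers L C2)
  (OK1 : ring_of_integers K1 = OL_adjoin kappa1)
  (OK2 : ring_of_integers K2 = OL_adjoin kappa2)
  (kappa1_eq : kappa1 ^+ 2 + B1%:A * kappa1 + C1%:A = 0)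
  (kappa2_eq : kappa2 ^+ 2 + B2%:A * kappa2 + C2%:A = 0)
  (m1_def : - m1 = B1 ^+ 2 - 4%:R * C1) (m2_def : - m2 = B2 ^+ 2 - 4%:R * C2)
  (O1 : set K1) (O2 : set K2) (c1 c2 : L)
  (O1_order : is_order O1) (O2_order : is_order O2)
  (c1_int : ring_of_integers L c1) (c2_int : ring_of_integers L c2)
  (O1_cond : has_conductor O1 c1) (O2_cond : has_conductor O2 c2)
  (sqrt_m1 : K1) (sqrt_m2 : K2)
  (sqrt_m1_def : sqrt_m1 ^+ 2 = (- m1)%:A)
  (sqrt_m2_def : sqrt_m2 ^+ 2 = (- m2)%:A)
  (B : falgType L) (i j : B) (a b : L)
  (B_quat : is_quaternion i j a b)
  (B_def : totally_definite i j R)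
  (phi1 : {lrmorphism K1 -> B}) (phi2 : {lrmorphism K2 -> B})
  (phi_neq : range phi1 <> range phi2)
  (O : set B) (O_order : is_order O)
  (O1_sub : phi1 @` O1 `<=` O) (O2_sub : phi2 @` O2 `<=` O)
  (d : set L) (d_disc : is_reduced_disc i j O d) :
  let k1 := phi1 (c1%:A * sqrt_m1) in
  let k2 := phi2 (c2%:A * sqrt_m2) in
  let alpha := Trd i j (k1 * k2) in
  ideal_dvd d (principal (4%:R * Nrd i j k1 * Nrd i j k2 - alpha ^+ 2))
  /\ forall (Nd : nat) (disc1 disc2 discL : rat),
       is_ideal_norm d Nd ->
       is_abs_disc (O1 : set (baseFieldType K1)) disc1 ->
       is_abs_disc (O2 : set (baseFieldType K2)) disc2 ->
       is_abs_disc (ring_of_integers L) discL ->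
       Nd%:R <= 4%:R ^+ g * (disc1 * disc2 / discL ^+ 4).
Proof.
move=> k1 k2 alpha.
have [[dimK1 _] [dimK2 _]] := (K1_CM, K2_CM).
have [Ok1' k1_sqr k1N1] := quadratic_sqrt dimK1 B1_int C1_int OK1 kappa1_eq
  O1_order O1_cond m1_def sqrt_m1_def.
have [Ok2' k2_sqr k2N1] := quadratic_sqrt dimK2 B2_int C2_int OK2 kappa2_eq
  O2_order O2_cond m2_def sqrt_m2_def.
have Ok1 : O k1 by apply: O1_sub; exists (c1%:A * sqrt_m1).
have Ok2 : O k2 by apply: O2_sub; exists (c2%:A * sqrt_m2).
have k1_sq : k1 * k1 = (- (c1 ^+ 2 * m1))%:A := embedding_sqr phi1 k1_sqr.
have k2_sq : k2 * k2 = (- (c2 ^+ 2 * m2))%:A := embedding_sqr phi2 k2_sqr.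
have k1_pure := pure_of_sqr B_quat k1_sq (embedding_notin_scalar phi1 k1N1).
have k2_pure := pure_of_sqr B_quat k2_sq (embedding_notin_scalar phi2 k2N1).
have N1E : Nrd i j k1 = c1 ^+ 2 * m1 := Nrd_pure B_quat k1_pure k1_sq.
have N2E : Nrd i j k2 = c2 ^+ 2 * m2 := Nrd_pure B_quat k2_pure k2_sq.
set D := 4%:R * Nrd i j k1 * Nrd i j k2 - alpha ^+ 2.
have [f normE] := real_embeddings_norm L_real.
have fD k : [/\ 0 <= f k D, f k D <= 4%:R * f k (Nrd i j k1) * f k (Nrd i j k2)
    & f k D = 0 -> k1 != 0 -> exists t, k2 = t *: k1].
  pose q l := coord (qbasis i j) l.
  have k1E : k1 = qelt i j 0 (q 1 k1) (q 2%:R k1) (q 3%:R k1).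
    by rewrite {1}(qeltK B_quat k1) k1_pure.
  have k2E : k2 = qelt i j 0 (q 1 k2) (q 2%:R k2) (q 3%:R k2).
    by rewrite {1}(qeltK B_quat k2) k2_pure.
  have := definite_pure_pair B_quat (B_def (f k)) (q 1 k1) (q 2%:R k1) (q 3%:R k1)
    (q 1 k2) (q 2%:R k2) (q 3%:R k2).
  by rewrite -k1E -k2E.
have D0 : D != 0.
  (* One embedding suffices, and there is one since [\dim {:L}] is positive: it makes [k2] a nonzero
     multiple of [k1], so both images equal [L + L k1]. *)
  apply/eqP=> D0; have [_ _ par] := fD (Ordinal (adim_gt0 {:L})).
  have k1_neq0 : k1 != 0.
    apply: contraNneq (embedding_notin_scalar phi1 k1N1) => k10.
    by rewrite -/k1 k10 mem0v.
  have k2_neq0 : k2 != 0.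
    apply: contraNneq (embedding_notin_scalar phi2 k2N1) => k20.
    by rewrite -/k2 k20 mem0v.
  have [|//|t k2E] := par; first by rewrite D0 rmorph0.
  have t0 : t != 0 by apply: contraNneq k2_neq0 => t0; rewrite k2E t0 scale0r.
  apply: phi_neq; rewrite (embedding_range dimK1 phi1 k1N1).
  rewrite (embedding_range dimK2 phi2 k2N1) -/k1 -/k2.
  apply/seteqP; split=> _ [u [v ->]]; exists u.
    by exists (v / t); rewrite k2E scalerA divfK.
  by exists (v * t); rewrite k2E scalerA.
have [dD dvd_D] := reduced_disc_dvd L_cl1 d_disc
  (disc_ideal_pure_pair B_quat O_order Ok1 Ok2 k1_pure k2_pure) D0.
split=> // Nd disc1 disc2 discL d_norm disc1E disc2E discLE.
have [[d_sub d_int] _] := d_disc.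
have NdD := index_le_norm discLE d_sub d_norm dD (d_int _ dD) D0.
have discL0 := abs_disc_gt0 discLE.
have le1 := quadratic_disc_lower_bound dimK1 B1_int C1_int OK1 kappa1_eq
  O1_order O1_cond disc1E discLE.
have le2 := quadratic_disc_lower_bound dimK2 B2_int C2_int OK2 kappa2_eq
  O2_order O2_cond disc2E discLE.
(* [c1 ^ 2 (B1 ^ 2 - 4 C1) = - (c1 ^ 2 m1)]; the norm of [-1] disappears under the absolute
   value. *)
rewrite -m1_def mulrN -scaleN1r alg_normZ normrM normrX normrN1 expr1n mul1r in le1.
rewrite -m2_def mulrN -scaleN1r alg_normZ normrM normrX normrN1 expr1n mul1r in le2.
have normD : `|alg_norm D| <=
    4%:R ^+ g * (`|alg_norm (c1 ^+ 2 * m1)| * `|alg_norm (c2 ^+ 2 * m2)|).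
  rewrite -L_deg -N1E -N2E -normrM -alg_normM.
  rewrite -[X in X * _]ger0_norm ?exprn_ge0 // -normrM -alg_normZ.
  (* The rational inequality is moved to [R], where norms are products over embeddings, and compared
     factor by factor. *)
  rewrite -(ler_rat R) !ratr_norm !normE !normr_prod; apply: ler_prod => k _.
  have [fD0 fDle _] := fD k; rewrite normr_ge0 /= ger0_norm //.
  rewrite embed_scale rmorph_nat rmorphM mulrA.
  exact: le_trans fDle (ler_norm _).
apply: le_trans NdD (le_trans normD _); rewrite ler_wpM2l ?exprn_ge0 //.
rewrite (_ : discL ^+ 4 = discL ^+ 2 * discL ^+ 2) -?exprD //.
rewrite ler_pdivlMr ?exprn_gt0 //.
apply: le_trans (ler_pM _ _ le1 le2); rewrite ?mulr_ge0 ?exprn_ge0 ?(ltW discL0) //.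
by rewrite exprD mulrACA.
Qed.
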